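(* Let $\alpha,\beta>0$. There is a constant $C$, independent of $f$ and $g$, such that: (i) if $f\in\Lambda^\alpha_{\mathcal{L}}$ (respectively $g\in\Lambda^\alpha_{\mathcal{H}}$), then $\mathcal{L}^{-\beta}f\in\Lambda^{\alpha+2\beta}_{\mathcal{L}}$ (respectively $\mathcal{H}^{-\beta}g\in\Lambda^{\alpha+2\beta}_{\mathcal{H}}$) and $$\|\mathcal{L}^{-\beta}f\|_{\Lambda^{\alpha+2\beta}_{\mathcal{L}}}\le C\|f\|_{\Lambda^\alpha_{\mathcal{L}}}\qquad\big(\text{respectively } \|\mathcal{H}^{-\beta}g\|_{\Lambda^{\alpha+2\beta}_{\mathcal{H}}}\le C\|g\|_{\Lambda^\alpha_{\mathcal{H}}}\big);$$ (ii) if $f\in L^\infty(\mathbb{R}^{n+1})$ (respectively $g\in L^\infty(\mathbb{R}^n)$), then $$\|\mathcal{L}^{-\beta}f\|_{\Lambda^\beta_{\mathcal{L}}}\le C\|f\|_\infty\qquad\big(\text{respectively } \|\mathcal{H}^{-\beta}g\|_{\Lambda^\beta_{\mathcal{H}}}\le C\|g\|_\infty\big).$$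
   Context: Fix $n\ge1$. Let $\mathcal{H}=-\Delta_x+|x|^2$ on $\mathbb{R}^n$ and $\mathcal{L}=\partial_t-\Delta_x+|x|^2$ on $\mathbb{R}^{n+1}\ni(t,x)$. Functions are identified when equal almost everywhere. For $y>0$, $f\in L^\infty(\mathbb{R}^{n+1})$, $g\in L^\infty(\mathbb{R}^n)$, the Poisson semigroups $\mathcal{P}_y=e^{-y\sqrt{\mathcal{L}}}$ and $P_y=e^{-y\sqrt{\mathcal{H}}}$ are $$\mathcal{P}_yf(t,x)=\frac{y}{2\sqrt\pi}\int_0^\infty\int_{\mathbb{R}^n}e^{-\frac{y^2}{4\tau}}\,\frac{e^{-\frac{|x-z|^2}{4}\coth\tau}\,e^{-\frac{|x+z|^2}{4}\tanh\tau}}{(2\pi\sinh2\tau)^{n/2}}\,f(t-\tau,z)\,dz\,\frac{d\tau}{\tau^{3/2}},$$ and $P_yg(x)$ is given by the same formula with $f(t-\tau,z)$ replaced by $g(z)$. For $\alpha>0$, with $k=[\alpha]+1$ ($[\cdot]$ the integer part), $\Lambda^\alpha_{\mathcal{L}}$ is the set of $f\in L^\infty(\mathbb{R}^{n+1})$ for which there is $C_k$ with $\|\partial_y^k\mathcal{P}_yf\|_{L^\infty(\mathbb{R}^{n+1})}\le C_ky^{-k+\alpha}$ for all $y>0$; its norm is $\|f\|_\infty+C$ with $C$ the infimum of such $C_k$. The space $\Lambda^\alpha_{\mathcal{H}}$ and its norm are defined identically for $g\in L^\infty(\mathbb{R}^n)$ with $P_y$ in place of $\mathcal{P}_y$ and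 $L^\infty(\mathbb{R}^n)$ in place of $L^\infty(\mathbb{R}^{n+1})$. For $\beta>0$, $$\mathcal{L}^{-\beta}f=\frac1{\Gamma(2\beta)}\int_0^\infty\mathcal{P}_\tau f\,\frac{d\tau}{\tau^{1-2\beta}},\qquad \mathcal{H}^{-\beta}g=\frac1{\Gamma(2\beta)}\int_0^\infty P_\tau g\,\frac{d\tau}{\tau^{1-2\beta}},$$ the integrals being taken pointwise. *)

(* Defs.v *)
From HB Require Import structures.
From mathcomp Require Import all_boot all_order all_algebra.
From mathcomp Require Import all_classical all_reals all_analysis.

Set Implicit Arguments.
Unset Strict Implicit.
Unset Printing Implicit Defensive.
Import Order.TTheory GRing.Theory Num.Theory.
Import numFieldNormedType.Exports.

Local Open Scope classical_set_scope.
Local Open Scope ring_scope.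

Section lebesgue_tuple.
Context {R : realType}.

Definition pcons n (p : measurableTypeR R * n.-tuple R) : n.+1.-tuple R :=
  [tuple of p.1 :: p.2].

Lemma measurable_pcons n : measurable_fun [set: measurableTypeR R * n.-tuple R] (@pcons n).
Proof. exact: measurable_cons. Qed.

Section lebesgue_cons.
Variables (n : nat) (mu : {sigma_finite_measure set (n.-tuple R) -> \bar R}).

Let prod_mu : {measure set (measurableTypeR R * n.-tuple R)%type -> \bar R} :=
  (@lebesgue_measure R \x mu)%E.

Definition lebesgue_cons : set (n.+1.-tuple R) -> \bar R :=
  pushforward (@lebesgue_measure R \x mu)%E (@pcons n).

Let mpreimage (A : set (n.+1.-tuple R)) :
  measurable A -> measurable (@pcons n @^-1` A).
Proof. by move=> mA; rewrite -[X in measurable X]setTI; exact: measurable_pcons. Qed.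

Let lebesgue_cons0 : lebesgue_cons set0 = 0%E.
Proof. by rewrite /lebesgue_cons /pushforward preimage_set0 (measure0 prod_mu). Qed.

Let lebesgue_cons_ge0 A : (0 <= lebesgue_cons A)%E.
Proof. exact: (measure_ge0 prod_mu). Qed.

Let lebesgue_cons_sigma_additive : semi_sigma_additive lebesgue_cons.
Proof.
move=> F mF tF mUF; rewrite /lebesgue_cons /pushforward preimage_bigcup.
apply: (@measure_semi_sigma_additive _ _ _ prod_mu
  (fun k => @pcons n @^-1` F k)).
- by move=> k; exact: mpreimage.
- apply/trivIsetP => /= i j _ _ ij; rewrite -preimage_setI.
  by move/trivIsetP : tF => /(_ _ _ _ _ ij) ->//; rewrite preimage_set0.
- by rewrite -preimage_bigcup; exact: mpreimage.
Qed.

HB.instance Definition _ := isMeasure.Build _ _ _ lebesgue_cons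
  lebesgue_cons0 lebesgue_cons_ge0 lebesgue_cons_sigma_additive.

Let lebesgue_cons_sigma_finite : sigma_finite setT lebesgue_cons.
Proof.
have /sigma_finiteP[F [TF ndF Foo]] := sigma_finiteT (@lebesgue_measure R).
have /sigma_finiteP[G [TG ndG Goo]] := sigma_finiteT mu.
exists (fun k => [set v | F k (thead v) /\ G k [tuple of behead v]]).
  apply/seteqP; split => // v _.
  have [i _ Fi] : (\bigcup_k F k) (thead v) by rewrite -TF.
  have [j _ Gj] : (\bigcup_k G k) [tuple of behead v] by rewrite -TG.
  exists (maxn i j) => //; split.
    by move: Fi; exact/subsetPset/ndF/leq_maxl.
  by move: Gj; exact/subsetPset/ndG/leq_maxr.
move=> k; have [mF Fk] := Foo k; have [mG Gk] := Goo k; split.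
  apply: measurableI; rewrite -[X in measurable X]setTI.
    exact: (@measurable_tnth _ R n.+1 ord0).
  exact: measurable_behead.
rewrite /lebesgue_cons /pushforward (_ : _ @^-1` _ = F k `*` G k); last first.
  by apply/seteqP; split => -[x v] /= [? Gv]; split => //;
    move: Gv; rewrite (_ : [tuple of _] = v)//; exact: val_inj.
by rewrite product_measure1E// lte_mul_pinfty// ge0_fin_numE.
Qed.

HB.instance Definition _ := Measure_isSigmaFinite.Build _ _ _ lebesgue_cons
  lebesgue_cons_sigma_finite.

End lebesgue_cons.

(* Lebesgue measure on R^n, whose points are the n-tuples with the library's
   product sigma-algebra. *)
Fixpoint lebesgue_tuple n : {sigma_finite_measure set (n.-tuple R) -> \bar R} :=
  if n is n'.+1 then lebesgue_cons (lebesgue_tuple n') else \d_([tuple] : 0.-tuple R).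

Lemma lebesgue_tuple_box n (A : 'I_n -> set R) :
  (forall i, measurable (A i)) ->
  lebesgue_tuple n [set v | forall i, A i (tnth v i)] =
  (\prod_(i < n) lebesgue_measure (A i))%E.
Proof.
elim: n A => [|n IH] A mA.
  by rewrite big_ord0 /= diracE mem_set// => -[].
rewrite big_ord_recl /= /lebesgue_cons /pushforward.
rewrite (_ : _ @^-1` _ =
    A ord0 `*` [set v | forall i, A (lift ord0 i) (tnth v i)]); last first.
  apply/seteqP; split => -[x v] /=.
    move=> Av; split; first exact: (Av ord0).
    by move=> i; have := Av (lift ord0 i); rewrite tnthS.
  move=> [Ax Av] i; case: (unliftP ord0 i) => [j|] ->; last by [].
  by rewrite tnthS.
rewrite product_measure1E//; [by congr (_ * _)%E; exact: IH|exact: mA|].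
rewrite [X in measurable X](_ : _ =
    \big[setI/setT]_(i < n) ((@tnth n R ^~ i) @^-1` A (lift ord0 i))).
  apply: bigsetI_measurable => i _; rewrite -[X in measurable X]setTI.
  exact: measurable_tnth.
apply/seteqP; split => v /=; rewrite -bigcap_seq /=.
  by move=> Av i _; exact: Av.
by move=> Av i; apply: Av; rewrite /= mem_index_enum.
Qed.

End lebesgue_tuple.

Section hyperbolic.
Context {R : realType}.
Implicit Types x : R.

Definition sinh x := (expR x - expR (- x)) / 2.
Definition cosh x := (expR x + expR (- x)) / 2.
Definition tanh x := sinh x / cosh x.
Definition coth x := cosh x / sinh x.

End hyperbolic.

Definition Gamma {R : realType} (s : R) : R :=
  \int[lebesgue_measure]_(u in `]0, +oo[) (u `^ (s - 1) * expR (- u)).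

Section poisson.
Context {R : realType} {n : nat}.
Implicit Types x z : n.-tuple R.

(* R^(n+1), with points (t, x). *)
Definition spacetime := (measurableTypeR R * n.-tuple R)%type.

Definition lebesgue_spacetime : {measure set spacetime -> \bar R} :=
  (@lebesgue_measure R \x lebesgue_tuple n)%E.

Definition sqdist x z : R := \sum_(i < n) (tnth x i - tnth z i) ^+ 2.
Definition sqsum x z : R := \sum_(i < n) (tnth x i + tnth z i) ^+ 2.

Definition mehler (tau : R) x z : R :=
  expR (- (sqdist x z / 4 * coth tau)) * expR (- (sqsum x z / 4 * tanh tau)) /
  (2 * pi * sinh (2 * tau)) `^ (n%:R / 2).

(* Common formula for both semigroups: h tau z is f (t - tau, z) or g z. *)
Definition subordination (y : R) x (h : R -> n.-tuple R -> R) : R :=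
  y / (2 * Num.sqrt pi) *
  \int[lebesgue_measure]_(tau in `]0, +oo[)
    ((\int[lebesgue_tuple n]_z
        (expR (- (y ^+ 2 / (4 * tau))) * mehler tau x z * h tau z))
     / tau `^ (3 / 2)).

Definition poissonL (y : R) (f : spacetime -> R) (p : spacetime) : R :=
  subordination y p.2 (fun tau z => f ((p.1 : R) - tau, z)).

Definition poissonH (y : R) (g : n.-tuple R -> R) x : R :=
  subordination y x (fun _ z => g z).

End poisson.
Arguments spacetime : clear implicits.

Section zygmund.
Context d (T : measurableType d) (R : realType).
Variables (mu : {measure set T -> \bar R}) (P : R -> (T -> R) -> T -> R).

(* Functions are representatives of their a.e. classes: the operators below are
   given by integrals whose values at every point depend only on the class. *)
Definition Linfty : set (T -> R) := [set f | f \in Lfun mu +oo%E].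

Definition Linfty_norm (f : T -> R) : \bar R := 'N[mu]_+oo[EFin \o f]%E.

(* For an essentially bounded f the Poisson semigroups are smooth in s > 0 at
   each point p, so the total derivative derive1n is the genuine one. *)
Definition zygmund_bounds (alpha : R) (f : T -> R) : set R :=
  let k := (Num.truncn alpha).+1 in
  [set C | forall y : R, 0 < y ->
    (Linfty_norm (fun p => derive1n k (fun s : R => P s f p) y) <=
       (C * y `^ (- k%:R + alpha))%:E)%E].

Definition Lambda (alpha : R) : set (T -> R) :=
  [set f | Linfty f /\ zygmund_bounds alpha f !=set0].

(* Equals +oo when zygmund_bounds alpha f is empty. *)
Definition Lambda_norm (alpha : R) (f : T -> R) : \bar R :=
  (Linfty_norm f + ereal_inf [set C%:E | C in zygmund_bounds alpha f])%E.

Definition negative_power (beta : R) (f : T -> R) (p : T) : R :=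
  (Gamma (2 * beta))^-1 *
  \int[lebesgue_measure]_(tau in `]0, +oo[)
    (P tau f p / tau `^ (1 - 2 * beta)).

End zygmund.

Section operators.
Context {R : realType} {n : nat}.

Definition LinftyL := Linfty (@lebesgue_spacetime R n).
Definition LinftyH := Linfty (@lebesgue_tuple R n).
Definition LinftyL_norm := Linfty_norm (@lebesgue_spacetime R n).
Definition LinftyH_norm := Linfty_norm (@lebesgue_tuple R n).
Definition LambdaL := Lambda (@lebesgue_spacetime R n) poissonL.
Definition LambdaH := Lambda (@lebesgue_tuple R n) poissonH.
Definition LambdaL_norm := Lambda_norm (@lebesgue_spacetime R n) poissonL.
Definition LambdaH_norm := Lambda_norm (@lebesgue_tuple R n) poissonH.
Definition powerL : R -> (spacetime R n -> R) -> spacetime R n -> R :=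
  negative_power poissonL.
Definition powerH : R -> (n.-tuple R -> R) -> n.-tuple R -> R :=
  negative_power poissonH.

End operators.

(* Main.v *)
From HB Require Import structures.
Require Import Defs.
From mathcomp Require Import all_boot all_order all_algebra.
From mathcomp Require Import all_classical all_reals all_analysis.
From mathcomp Require Import measurable_realfun ess_sup_inf ring lra.
Import Order.TTheory GRing.Theory Num.Theory.
Import numFieldNormedType.Exports.
Local Open Scope classical_set_scope.
Local Open Scope ring_scope.

Set Implicit Arguments.
Unset Strict Implicit.
Unset Printing Implicit Defensive.

(** Write D^k P_y for the k-th derivative in y of the Poisson semigroup of L.
    It is an integral operator, and the whole proof rests on two properties of
    its kernels.  One is the semigroup law for derivatives,
      D^m P_a D^k P_b = D^(m+k) P_(a+b).
    The other is the bound, uniform in p,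
      \int |D^k K_y(p, q)| dq <= C y^(-m)    for every real m >= k.
    For m = k this is scaling; the room m > k, which makes P_y decay faster than
    any power of y, comes from the spectral gap of the harmonic oscillator.

    From the semigroup law,
      D^l P_y L^(-beta) f =
        Gamma(2 beta)^(-1) \int_0^oo (D^l P_(y+s) f) s^(2 beta - 1) ds,
    and \int_0^oo (y + s)^(-m) s^(2 beta - 1) ds = C y^(2 beta - m) when
    m > 2 beta.  So a bound A y^(-m) for D^l P_y f turns into C A y^(2 beta - m)
    for D^l P_y L^(-beta) f (kernel_op_potential_le).
    In (i), with k = [alpha] + 1 and l = [alpha + 2 beta] + 1, the identity
    D^l P_y f = D^(l-k) P_(y/2) (D^k P_(y/2) f) gives such a bound with
    m = l - alpha (regularity_of_negative_power).  In (ii), with l = [beta] + 1,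
    the kernel bound gives it with m = l + beta (negative_power_Linfty).
    The bounds with m = beta for small s and m = 3 beta for large s make the
    integral defining L^(-beta) f converge to a bounded function.
    All of this only uses the properties collected in the record poisson_kernel.

    The kernel is eta_y(t - s) M_(t-s)(x, z) for s < t, where M is Mehler's
    kernel and eta_y is the density of the one-half stable subordinator.  The
    semigroup law comes from those of M (a Gaussian integral in each
    coordinate) and of eta (stable_convolution).  The kernel bound comes from
    \int M_t(x, z) dz <= sqrt 2 e^(-t), which is the spectral gap, and from
    estimates of the derivatives of eta_y (stable_density_le).

    The elliptic case is contained in the parabolic one: a function g of x
    alone is a bounded function of (t, x), on which the two semigroups agree,
    and the two essential norms agree by Fubini. *)

(** * Improper integrals of nonnegative functions *)

Section exhaustion.
Context {R : realType}.
Notation mu := (@lebesgue_measure R).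
Implicit Types (f F : R -> R) (u v : nat -> R) (S : set R).

(** Monotone convergence carries the fundamental theorem of calculus from compact
    intervals to their union, so the integrand may be singular at the ends of S
    and its integral may a priori be infinite. *)
Lemma ge0_FTC2_exhaustion f F u v S :
  (forall n, u n < v n) -> nonincreasing_seq u -> nondecreasing_seq v ->
  S = \bigcup_n `[u n, v n]%classic ->
  (forall x, S x -> 0 <= f x) ->
  (forall x, S x -> {for x, continuous f}) ->
  (forall x, S x -> is_derive x 1 F (f x)) ->
  (F (v n) - F (u n))%:E @[n --> \oo] --> (\int[mu]_(x in S) (f x)%:E)%E.
Proof.
move=> uv du iv SE f0 cf dF.
have sub n : `[u n, v n]%classic `<=` S by rewrite SE => x ux; exists n.
have ndI : nondecreasing_seq (fun n => `[u n, v n]%classic : set R).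
  move=> m n mn; apply/subsetPset => x /=; rewrite !in_itv/= => /andP[ux xv].
  by rewrite (le_trans (du _ _ mn) ux) (le_trans xv (iv _ _ mn)).
have mf n : measurable_fun `[u n, v n]%classic f.
  apply: subspace_continuous_measurable_fun => //.
  by apply: continuous_in_subspaceT => x /set_mem /(sub n); exact: cf.
have mS : measurable S by rewrite SE; exact: bigcupT_measurable.
have mfS : measurable_fun S (EFin \o f).
  by apply/measurable_EFinP; rewrite SE; apply/measurable_fun_bigcup.
have := @ge0_nondecreasing_set_cvg_integral _ (measurableTypeR R) R (fun n => `[u n, v n]%classic)
  (EFin \o f) (@lebesgue_measure R) ndI (fun n => measurable_itv _) _ _.
rewrite -SE => cvgI.
have {}cvgI := cvgI (fun n => (measurable_EFinP _ _).2 (mf n)) (fun n x ux => f0 x (sub n x ux)).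
apply: cvg_trans cvgI; apply: near_eq_cvg; apply: nearW => n /=.
rewrite (@continuous_FTC2 _ f F)//.
- by apply: continuous_in_subspaceT => x /set_mem /(sub n); exact: cf.
- have cF x : x \in `[u n, v n] -> {for x, continuous F}.
    move=> xuv; apply: differentiable_continuous.
    apply/derivable1_diffP; have := dF x (sub n x xuv).
    by move=> d; exact: ex_derive.
  split.
  + by move=> x /subset_itv_oo_cc xuv; have d := dF x (sub n x xuv); exact: ex_derive.
  + apply: cvg_at_right_filter; apply: cF.
    by rewrite in_itv/= lexx ltW.
  + apply: cvg_at_left_filter; apply: cF.
    by rewrite in_itv/= lexx ltW.
- move=> x /subset_itv_oo_cc xuv; have d := dF x (sub n x xuv).
  by rewrite derive1E derive_val.
Qed.

Lemma pos_exhaustion :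
  `]0, +oo[%classic = \bigcup_n `[n.+1%:R^-1, n.+2%:R]%classic :> set R.
Proof.
apply/seteqP; split => x /=; rewrite in_itv/= ?andbT; last first.
  by move=> [n _ /=]; rewrite in_itv/= => /andP[+ _]; apply: lt_le_trans; rewrite invr_gt0.
move=> x0; have h0 : 0 <= x + x^-1 by rewrite addr_ge0 ?invr_ge0 ?ltW.
have nx := archi_boundP h0.
exists (Num.bound (x + x^-1)) => //=; rewrite in_itv/=; apply/andP; split.
  rewrite -[leRHS]invrK lef_pV2 ?posrE ?invr_gt0//.
  rewrite -natr1; have : x^-1 <= x + x^-1 by rewrite lerDr ltW.
  by lra.
rewrite -natr1 -natr1; have : 0 <= x^-1 by rewrite invr_ge0 ltW.
by lra.
Qed.

(** Bounding the increments of the primitive spares the computation of its limits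
    at 0 and at infinity. *)
Lemma ge0_FTC2_pos_le f F (B : R) :
  (forall x : R, 0 < x -> 0 <= f x) ->
  (forall x : R, 0 < x -> {for x, continuous f}) ->
  (forall x : R, 0 < x -> is_derive x 1 F (f x)) ->
  (forall a b : R, 0 < a -> a < b -> F b - F a <= B) ->
  (\int[mu]_(x in `]0%R, +oo[) (f x)%:E <= B%:E)%E.
Proof.
move=> f0 cf dF FB.
have S (x : R) : `]0%R, +oo[%classic x -> 0 < x by rewrite /= in_itv/= andbT.
have uv n : (n.+1%:R^-1 : R) < n.+2%:R.
  by rewrite (@le_lt_trans _ _ 1) ?ltr1n// invf_le1 ?ler1n.
have cv : (F n.+2%:R - F n.+1%:R^-1)%:E @[n --> \oo] --> (\int[mu]_(x in `]0%R, +oo[) (f x)%:E)%E.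
  apply: (@ge0_FTC2_exhaustion f F (fun n => n.+1%:R^-1) (fun n => n.+2%:R) `]0%R, +oo[%classic) => //.
  - by move=> m n mn; rewrite lef_pV2 ?posrE// ler_nat.
  - by move=> m n mn; rewrite ler_nat.
  - exact: pos_exhaustion.
  - by move=> x /S; exact: f0.
  - by move=> x /S; exact: cf.
  - by move=> x /S; exact: dF.
move/cvg_lim : (cv) => <- //.
apply: lime_le; first by apply/cvg_ex; eexists; exact: cv.
by apply: nearW => n; rewrite lee_fin FB ?invr_gt0.
Qed.

Lemma ler_powRN (m a b : R) : 0 <= m -> 0 < a -> a <= b -> b `^ (- m) <= a `^ (- m).
Proof.
move=> m0 a0 ab; have b0 := lt_le_trans a0 ab.
by rewrite !powRN lef_pV2 ?posrE ?powR_gt0// ge0_ler_powR// ?nnegrE ltW.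
Qed.

Lemma continuous_powR (a x : R) : 0 < x -> {for x, continuous (fun t : R => t `^ a)}.
Proof.
move=> x0; apply: differentiable_continuous; apply/derivable1_diffP.
by have d := is_derive1_powR a x0; exact: ex_derive.
Qed.

Lemma integral_powRD_le (m y : R) : 0 < m -> 0 < y ->
  (\int[mu]_(t in `]0%R, +oo[) ((t + y) `^ (- 1 - m))%:E <= (m^-1 * y `^ (- m))%:E)%E.
Proof.
move=> m0 y0; apply: (@ge0_FTC2_pos_le _ (fun t => - m^-1 * (t + y) `^ (- m))).
- by move=> x _; exact: powR_ge0.
- move=> x x0; apply: (@continuous_comp _ _ _ (fun t => t + y) (fun t => t `^ (- 1 - m))).
    by apply: cvgD; [exact: cvg_id|exact: cvg_cst].
  by apply: continuous_powR; rewrite addr_gt0.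
- move=> x x0; have xy : 0 < x + y by rewrite addr_gt0.
  have d := is_derive1_powR (- m) xy.
  have d1 : is_derive x 1 (fun t : R => t + y) (1 + 0) by exact: is_deriveD.
  have d2 := @is_derive1_comp _ (fun t => t `^ (- m)) (fun t => t + y) x _ _ d d1.
  have := @is_deriveZ _ _ _ _ (- m^-1) _ _ _ d2.
  rewrite (_ : _ *: _ = (x + y) `^ (- 1 - m)); last first.
    rewrite /GRing.scale/= (_ : - m - 1 = -1 - m); last by ring.
    by field; rewrite gt_eqF.
  by [].
- move=> a b a0 ab.
  have : 0 <= (b + y) `^ (- m) by exact: powR_ge0.
  have : (a + y) `^ (- m) <= y `^ (- m).
    by rewrite ler_powRN ?ltW// ltrDr.
  have : 0 < m^-1 by rewrite invr_gt0.
  by nra.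
Qed.

(** Up to constants y + s is (y^g + s^g)^(1/g), and once y + s is replaced by that
    the integrand is the derivative of a power of y^g + s^g. *)
Lemma integral_powR_powRD_le (g m : R) : 0 < g -> g < m ->
  exists2 C, 0 <= C & forall y : R, 0 < y ->
  (\int[mu]_(s in `]0%R, +oo[) (s `^ (g - 1) * (y + s) `^ (- m))%:E
     <= (C * y `^ (g - m))%:E)%E.
Proof.
move=> g0 gm; have m0 : 0 < m by exact: lt_trans gm.
(* With this e, (y + s)^m = ((y + s)^g)^e. *)
pose e := m / g; have e1 : 1 < e by rewrite ltr_pdivlMr// mul1r.
pose c := (2 `^ e * (g * (e - 1))^-1).
have c0 : 0 <= c.
  by rewrite mulr_ge0 ?powR_ge0// invr_ge0 mulr_ge0 ?ltW// subr_gt0.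
exists c => // y y0.
pose w s := y `^ g + s `^ g.
have w0 (s : R) : 0 < s -> 0 < w s by move=> s0; rewrite addr_gt0 ?powR_gt0.
have dw (s : R) : 0 < s -> is_derive s 1 w (g * s `^ (g - 1)).
  move=> s0; have d := is_derive1_powR g s0.
  rewrite -[X in is_derive _ _ _ X]add0r.
  exact: is_deriveD.
have key (s : R) : 0 < s ->
    s `^ (g - 1) * (y + s) `^ (- m) <= 2 `^ e * (s `^ (g - 1) * w s `^ (- e)).
  move=> s0; rewrite mulrCA ler_wpM2l ?powR_ge0//.
  have ys : 0 < y + s by rewrite addr_gt0.
  have wys : w s <= 2 * (y + s) `^ g.
    have : y `^ g <= (y + s) `^ g by rewrite ge0_ler_powR ?nnegrE ?ltW// ltrDl.
    have : s `^ g <= (y + s) `^ g by rewrite ge0_ler_powR ?nnegrE ?ltW// ltrDr.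
    by rewrite /w; lra.
  have eg : m = g * e by rewrite /e mulrCA divff ?mulr1 ?gt_eqF.
  have e0 : 0 < e by exact: lt_trans e1.
  have -> : (y + s) `^ (- m) = 2 `^ e * (2 * (y + s) `^ g) `^ (- e).
    rewrite powRM ?powR_ge0// mulrA -powRrM mulrN -eg.
    by rewrite (powRN 2) mulfV ?mul1r// gt_eqF// powR_gt0.
  apply: ler_wpM2l; first exact: powR_ge0.
  by apply: ler_powRN; [exact: ltW|exact: w0|exact: wys].
apply: (@le_trans _ _ (\int[mu]_(s in `]0%R, +oo[) (2 `^ e * (s `^ (g - 1) * w s `^ (- e)))%:E)%E).
  apply: ge0_le_integral => //=.
  - by move=> s _; rewrite lee_fin mulr_ge0// powR_ge0.
  - apply/measurable_EFinP/measurable_funM; apply: measurable_funTS.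
      exact: measurable_powR.
    by apply: (measurableT_comp (measurable_powR _)); apply: measurable_funD.
  - apply/measurable_EFinP/measurable_funM => //; apply: measurable_funM; apply: measurable_funTS.
      exact: measurable_powR.
    apply: (measurableT_comp (measurable_powR _)); apply: measurable_funD => //.
  - by move=> s; rewrite /= in_itv/= andbT => s0; rewrite lee_fin; exact: key.
apply: (@ge0_FTC2_pos_le (fun s => 2 `^ e * (s `^ (g - 1) * w s `^ (- e))) (fun s => - c * w s `^ (1 - e)) (c * y `^ (g - m))).
- by move=> x _; rewrite !mulr_ge0 ?powR_ge0.
- move=> x x0; apply: cvgM; first exact: cvg_cst.
  apply: cvgM; first exact: continuous_powR.
  apply: (@continuous_comp _ _ _ w (fun t => t `^ (- e))).
    by apply: cvgD; [exact: cvg_cst|exact: continuous_powR].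
  by apply: continuous_powR; exact: w0.
- move=> x x0.
  have d := is_derive1_powR (1 - e) (w0 x x0).
  have d2 := @is_derive1_comp _ (fun t => t `^ (1 - e)) w x _ _ d (dw x x0).
  have := @is_deriveZ _ _ _ _ (- c) _ _ _ d2.
  rewrite (_ : _ *: _ = 2 `^ e * (x `^ (g - 1) * w x `^ (- e)))//.
  rewrite /GRing.scale/= /c (_ : 1 - e - 1 = - e); last by ring.
  by field; rewrite !gt_eqF// subr_gt0.
- move=> a b a0 ab.
  have : 0 <= w b `^ (1 - e) by exact: powR_ge0.
  have -> : y `^ (g - m) = (y `^ g) `^ (1 - e).
    by rewrite -powRrM; congr (_ `^ _); rewrite /e; field; rewrite gt_eqF.
  have : w a `^ (1 - e) <= (y `^ g) `^ (1 - e).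
    rewrite -(opprB e 1); apply: ler_powRN; [by rewrite subr_ge0 ltW|exact: powR_gt0|].
    by rewrite lerDl; exact: powR_ge0.
  move=> /(ler_wpM2l c0) h1 /(mulr_ge0 c0) h2.
  by rewrite mulNr mulNr opprK addrC lerBlDr (le_trans h1)// lerDl.
Qed.
End exhaustion.

(** * Gaussian decay *)

Section decay.
Context {R : realType}.
Implicit Types x u nu N : R.

Lemma exprn_le_expR n x : 0 <= x -> x ^+ n <= n`!%:R * expR x.
Proof.
move=> x0; case: n => [|n].
  by rewrite expr0 fact0 mul1r -expR0 ler_expR.
have := expR_ge1Dxn n x0.
rewrite -ler_pdivrMl ?ltr0n ?fact_gt0// mulrC; apply: le_trans.
by rewrite lerDr.
Qed.

Lemma powR_le_expR nu : 0 <= nu ->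
  exists2 C : R, 0 <= C & forall x, 0 <= x -> (1 + x) `^ nu <= C * expR (x / 4).
Proof.
move=> nu0; have nuN := archi_boundP nu0; set N := Num.bound nu in nuN.
exists (4 ^+ N * N`!%:R * expR 1); first by rewrite !mulr_ge0// ?exprn_ge0// expR_ge0.
move=> x x0; apply: (@le_trans _ _ ((1 + x) ^+ N)).
  by rewrite -powR_mulrn ?addr_ge0// ler_powR ?lerDl// ltW.
apply: (@le_trans _ _ ((4 * (1 + x / 4)) ^+ N)).
  by rewrite lerXn2r ?nnegrE; lra.
rewrite exprMn -!mulrA ler_wpM2l ?exprn_ge0// -expRD.
by apply: exprn_le_expR; lra.
Qed.

Lemma powR_expRN_le nu : 0 <= nu ->
  exists2 C : R, 0 <= C & forall x, 0 <= x -> x `^ nu * expR (- x) <= C.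
Proof.
move=> nu0; have [C C0 CP] := powR_le_expR nu0; exists C => // x x0.
rewrite expRN ler_pdivrMr ?expR_gt0//; apply: (@le_trans _ _ ((1 + x) `^ nu)).
  by rewrite ge0_ler_powR ?nnegrE ?addr_ge0// lerDr.
by apply: (le_trans (CP x x0)); rewrite ler_wpM2l// ler_expR; lra.
Qed.

Lemma horner_growth (p : {poly R}) :
  exists m, exists2 C : R, 0 <= C & forall u, `|p.[u]| <= C * (1 + u ^+ 2) ^+ m.
Proof.
elim/poly_ind: p => [|p c [m [C C0 IH]]].
  by exists 0%N, 0 => // u; rewrite horner0 normr0 mul0r.
exists m.+1, (C + `|c|); first by rewrite addr_ge0.
move=> u; rewrite hornerD hornerM hornerX hornerC.
have u1 : 1 <= 1 + u ^+ 2 by rewrite lerDl sqr_ge0.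
apply: (le_trans (ler_normD _ _)); rewrite mulrDl; apply: lerD.
  rewrite normrM exprSr mulrA; apply: ler_pM => //.
  by rewrite ler_norml; apply/andP; split; nra.
by rewrite ler_peMr// exprn_ege1.
Qed.

Lemma horner_gauss_decay (p : {poly R}) N : 0 <= N ->
  exists2 C : R, 0 <= C & forall u,
    `|p.[u]| * expR (- (u ^+ 2 / 4)) <= C * (1 + u ^+ 2) `^ (- N).
Proof.
move=> N0; have [m [C C0 pC]] := horner_growth p.
have mN : 0 <= m%:R + N by rewrite addr_ge0.
have [D D0 DP] := powR_le_expR mN.
exists (C * D); first exact: mulr_ge0.
move=> u; have u1 : 0 < 1 + u ^+ 2 by rewrite ltr_wpDr ?sqr_ge0.
rewrite expRN ler_pdivrMr ?expR_gt0//; apply: (le_trans (pC u)).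
set e := expR _; rewrite -!mulrA; apply: ler_wpM2l => //.
have := DP _ (sqr_ge0 u).
rewrite powRD; last by rewrite (gt_eqF u1) implybT.
rewrite powR_mulrn ?(ltW u1)// => h.
by rewrite powRN mulrCA [leRHS]mulrC ler_pdivlMr ?powR_gt0.
Qed.

End decay.

(** * The density of the one-half stable subordinator *)

Section stable_density.
Context {R : realType}.
Implicit Types y t : R.

(** Differentiating p(u) e^(-u^2/4) produces (p' - u p / 2) e^(-u^2/4); starting
    from p = u these are Hermite polynomials up to scaling. *)
Fixpoint stable_poly (k : nat) : {poly R} :=
  if k is j.+1 then (stable_poly j)^`() - 2^-1 *: ('X * stable_poly j) else 'X.

(** The k-th derivative in y of y / (2 sqrt pi t^(3/2)) e^(-y^2/(4t)), the density
    at t of the one-half stable subordinator at time y.  Powers of t are taken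
    with powR, which is measurable for every real exponent. *)
Definition stable_density (k : nat) y t : R :=
  (2 * Num.sqrt pi)^-1 * (t `^ (- 2^-1)) ^+ k.+2 *
  ((stable_poly k).[y * t `^ (- 2^-1)] *
   expR (- ((y * t `^ (- 2^-1)) ^+ 2 / 4))).

Lemma is_derive_gauss (w : R) :
  is_derive w 1 (fun u : R => expR (- (u ^+ 2 / 4))) (expR (- (w ^+ 2 / 4)) * (- w / 2)).
Proof.
pose q : {poly R} := - 4^-1 *: 'X^2.
have qE u : q.[u] = - (u ^+ 2 / 4) by rewrite /q hornerZ hornerXn; ring.
have dq := is_derive_poly q w.
have de := is_derive_expR q.[w].
have := @is_derive1_comp _ _ _ w _ _ de dq.
rewrite qE (_ : q^`().[w] = - w / 2); last first.
  by rewrite /q derivZ derivXn hornerZ hornerMn hornerX -mulr_natr; field.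
by rewrite (_ : expR \o horner q = (fun u => expR (- (u ^+ 2 / 4))))//; apply/funext => u /=; rewrite qE.
Qed.

Lemma is_derive_stable_density k y t :
  is_derive y 1 (fun y => stable_density k y t) (stable_density k.+1 y t).
Proof.
rewrite /stable_density; set s := t `^ _.
set c := (2 * Num.sqrt pi)^-1.
have d1 : is_derive y 1 (fun y => y * s) s.
  have := is_deriveM (is_derive_id y 1) (is_derive_cst s y 1).
  by rewrite scaler0 add0r /GRing.scale/= mulr1.
have d2 := @is_derive1_comp _ _ (fun y => y * s) y _ _ (is_derive_poly (stable_poly k) (y * s)) d1.
have d4 := @is_derive1_comp _ _ (fun y => y * s) y _ _ (is_derive_gauss (y * s)) d1.
have d5 := is_deriveM d2 d4.
have := @is_deriveZ _ _ _ _ (c * s ^+ k.+2) _ _ _ d5.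
rewrite (_ : _ *: _ = c * s ^+ k.+3 * ((stable_poly k.+1).[y * s] * expR (- ((y * s) ^+ 2 / 4))))//.
rewrite /GRing.scale/= !hornerE !exprS /=.
by field.
Qed.

Lemma measurable_stable_density k :
  measurable_fun setT (fun v : R * R => stable_density k v.1 v.2).
Proof.
have ms : measurable_fun setT (fun v : R * R => v.2 `^ (- 2^-1)).
  by apply: (measurableT_comp (measurable_powR _)); exact: measurable_snd.
have mys : measurable_fun setT (fun v : R * R => v.1 * v.2 `^ (- 2^-1)).
  by apply: measurable_funM => //; exact: measurable_fst.
apply: measurable_funM.
  by apply: measurable_funM => //; exact: measurable_funX.
apply: measurable_funM.
  apply: (@measurableT_comp _ _ _ _ _ _ (horner (stable_poly k))) => //.
  exact: measurable_poly.
apply: measurableT_comp => //; apply: measurableT_comp => //.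
by apply: measurable_funM => //; exact: measurable_funX.
Qed.

Lemma stable_density0_ge0 y t : 0 <= y -> 0 <= stable_density 0 y t.
Proof.
move=> y0; rewrite /stable_density/= hornerX.
by rewrite !mulr_ge0 ?invr_ge0 ?mulr_ge0 ?sqrtr_ge0 ?exprn_ge0 ?powR_ge0 ?expR_ge0.
Qed.

Lemma powRN2_sqr t : 0 < t -> (t `^ (- 2^-1)) ^+ 2 = t^-1.
Proof.
move=> t0; rewrite -powR_mulrn ?powR_ge0// -powRrM (_ : - 2^-1 * 2%:R = -1); last by field.
by rewrite powR_inv1 // ltW.
Qed.

(** Turns decay in the self-similar variable y / sqrt t into decay in t + y^2. *)
Lemma powR_addrV y t (N : R) : 0 < t ->
  (1 + (y * t `^ (- 2^-1)) ^+ 2) `^ (- N) = t `^ N * (t + y ^+ 2) `^ (- N).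
Proof.
move=> t0; rewrite exprMn powRN2_sqr//.
have ty : 0 < t + y ^+ 2 by rewrite ltr_wpDr ?sqr_ge0.
rewrite (_ : 1 + y ^+ 2 / t = (t + y ^+ 2) * t^-1); last by field; rewrite gt_eqF.
rewrite powRM ?invr_ge0 ?(ltW t0) ?(ltW ty)// mulrC; congr (_ * _).
by rewrite -powR_inv1 ?(ltW t0)// -powRrM mulN1r opprK.
Qed.

Lemma stable_density_decay k (N : R) : 0 <= N ->
  exists2 C : R, 0 <= C & forall y t, 0 < t ->
    `|stable_density k y t| <= C * (t `^ (- (k.+2%:R / 2) + N) * (t + y ^+ 2) `^ (- N)).
Proof.
move=> N0; have [C C0 CP] := horner_gauss_decay (stable_poly k) N0.
have c0 : 0 <= (2 * Num.sqrt pi)^-1 :> R by rewrite invr_ge0 mulr_ge0 ?sqrtr_ge0.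
exists ((2 * Num.sqrt pi)^-1 * C); first exact: mulr_ge0.
move=> y t t0; rewrite /stable_density.
have -> : (t `^ (- 2^-1)) ^+ k.+2 = t `^ (- (k.+2%:R / 2)).
  by rewrite -powR_mulrn ?powR_ge0// -powRrM; congr (_ `^ _); field.
rewrite normrM (ger0_norm (mulr_ge0 c0 (powR_ge0 _ _))) normrM (ger0_norm (expR_ge0 _)).
rewrite powRD; last by rewrite (gt_eqF t0) implybT.
have := CP (y * t `^ (- 2^-1)); rewrite powR_addrV//.
set e := expR _; set A := t `^ (- (_ / 2)); set B := t `^ N; set D := (t + _) `^ _ => h.
rewrite [leRHS](_ : _ = (2 * Num.sqrt pi)^-1 * A * (C * (B * D))); last by ring.
by apply: ler_wpM2l => //; rewrite mulr_ge0 ?powR_ge0.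
Qed.

(** Scaling alone gives m = k.  For larger m the decay in t + y^2 costs the
    growing factor t^((m - k) / 2), which is absorbed by e^(-t). *)
Lemma stable_density_le k (m : R) : k%:R <= m ->
  exists2 C : R, 0 <= C & forall y t, 0 < t ->
    `|stable_density k y t| * expR (- t) <= C * (t + y ^+ 2) `^ (- 1 - m / 2).
Proof.
move=> km; have m0 : 0 <= m by exact: le_trans km.
have N0 : 0 <= 1 + m / 2 by lra.
have [C C0 CP] := stable_density_decay k N0.
have nu0 : 0 <= (m - k%:R) / 2 by lra.
have [D D0 DP] := powR_expRN_le nu0.
exists (C * D); first exact: mulr_ge0.
move=> y t t0.
have ty : 0 <= (t + y ^+ 2) `^ (- (1 + m / 2)) by exact: powR_ge0.
apply: (le_trans (ler_wpM2r (expR_ge0 _) (CP y t t0))).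
rewrite (_ : - (k.+2%:R / 2) + (1 + m / 2) = (m - k%:R) / 2); last first.
  by rewrite -[k.+2%:R]natr1 -natr1; field.
rewrite -opprD -!mulrA ler_wpM2l//.
have := DP t (ltW t0); set A := t `^ _; set e := expR _; set B := (t + _) `^ _ in ty * => h.
by rewrite [leLHS](_ : _ = A * e * B); [exact: ler_wpM2r|ring].
Qed.

(** The right-hand side has total mass in t bounded uniformly in y, which gives the
    kernel bound for k = m = 0, where stable_density_le would only leave
    (t + y^2)^(-1), which is not integrable in t. *)
Lemma stable_density0_le :
  exists2 C : R, 0 <= C & forall y t, 0 < y -> 0 < t ->
    stable_density 0 y t <= C * (y * (t + y ^+ 2) `^ (- 1 - 2^-1)).
Proof.
have N0 : 0 <= 3 / 2 :> R by lra.
have [C C0 CP] := horner_gauss_decay (1 : {poly R}) N0.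
have c0 : 0 <= (2 * Num.sqrt pi)^-1 :> R by rewrite invr_ge0 mulr_ge0 ?sqrtr_ge0.
exists ((2 * Num.sqrt pi)^-1 * C); first exact: mulr_ge0.
move=> y t y0 t0; rewrite /stable_density/= hornerX.
have := CP (y * t `^ (- 2^-1)); rewrite hornerC normr1 mul1r powR_addrV//.
rewrite (_ : - 1 - 2^-1 = - (3 / 2)); last by field.
have e3 : t `^ (- 2^-1) ^+ 3 * t `^ (3 / 2) = 1.
  rewrite -powR_mulrn ?powR_ge0// -powRrM -powRD; last by rewrite (gt_eqF t0) implybT.
  by rewrite (_ : _ + _ = 0) ?powRr0//; field.
set e := expR _; set s := t `^ _ in e3 *; set T := t `^ _ in e3 *; set P := (t + _) `^ _ => h.
rewrite -!mulrA ler_wpM2l//.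
rewrite [leLHS](_ : _ = y * s ^+ 3 * e); last by ring.
rewrite [leRHS](_ : _ = y * s ^+ 3 * (C * (T * P))); last first.
  by rewrite [RHS](_ : _ = y * (s ^+ 3 * T) * C * P); [rewrite e3; ring|ring].
by apply: ler_wpM2l => //; rewrite mulr_ge0 ?(ltW y0)// exprn_ge0 ?powR_ge0.
Qed.

End stable_density.

Section gauss_primitive.
Context {R : realType}.
Notation mu := (@lebesgue_measure R).

(** The error function, obtained from the cumulative distribution function of the
    centred normal law of variance 1/2, for which the limits are known. *)
Lemma gauss_primitive : exists E : R -> R,
  [/\ forall x : R, is_derive x 1 E (expR (- x ^+ 2)),
      E x @[x --> -oo%R] --> (0 : R) & E x @[x --> +oo%R] --> (Num.sqrt pi : R)].
Proof.
pose sg : R := Num.sqrt 2^-1.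
have sg2 : sg ^+ 2 *+ 2 = 1.
  by rewrite /sg sqr_sqrtr// -mulr_natr mulVf.
have sg0 : sg != 0 by rewrite /sg sqrtr_eq0 -ltNge.
have pdfE x : normal_pdf 0 sg x = (Num.sqrt pi)^-1 * expR (- x ^+ 2).
  rewrite normal_pdfE// /normal_peak /normal_fun.
  by rewrite sg2 subr0 divr1 -mulrnAl sg2 mul1r.
have spi : 0 < Num.sqrt pi :> R by rewrite sqrtr_gt0 pi_gt0.
have ipdf := @integrable_normal_pdf R 0 sg.
pose F (x : R) := \int[mu]_(t in `]-oo, x]) normal_pdf 0 sg t.
have dF (x : R) : is_derive x 1 F (normal_pdf 0 sg x).
  have xx1 : x < x + 1 by rewrite ltrDl.
  have iF : mu.-integrable `]-oo, (x + 1)] (EFin \o normal_pdf 0 sg).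
    by apply: (integrableS _ _ _ ipdf).
  have [dFx F'x] := @continuous_FTC1 _ (normal_pdf 0 sg) -oo%O x (x + 1) xx1 iF
    (ltNyr _) (@continuous_normal_pdf _ 0 sg sg0 x).
  by apply: DeriveDef; [exact: dFx|rewrite -derive1E; exact: F'x].
pose P := @normal_prob R 0 sg.
have mid : (fun x : measurableTypeR R => x : R) \in mfun.
  by rewrite inE; exact: measurable_id.
pose X : {RV P >-> R} := mfun_Sub mid.
have FE x : (F x)%:E = cdf X x.
  rewrite /F /Rintegral fineK//.
  by apply: integrable_fin_num => //; apply: (integrableS _ _ _ ipdf).
exists (fun x => Num.sqrt pi * F x); split.
- move=> x; have := @is_deriveZ _ _ _ _ (Num.sqrt pi) _ _ _ (dF x).
  by rewrite /GRing.scale/= pdfE mulrA mulfV ?mul1r// gt_eqF.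
- rewrite -(mulr0 (Num.sqrt pi)); apply: cvgM; first exact: cvg_cst.
  apply: (fine_cvg (f := fun x => (F x)%:E) (a := 0)).
  by under eq_fun do rewrite FE; exact: cvg_cdfNy0.
- rewrite -[X in _ --> X](mulr1 (Num.sqrt pi)); apply: cvgM; first exact: cvg_cst.
  apply: (fine_cvg (f := fun x => (F x)%:E) (a := 1)).
  by under eq_fun do rewrite FE; exact: cvg_cdfy1.
Qed.
End gauss_primitive.

(** * The convolution semigroup of the subordinator *)

Section subordinator_semigroup.
Context {R : realType}.
Notation mu := (@lebesgue_measure R).

Lemma stable_density0E (y t : R) : 0 < t ->
  stable_density 0 y t =
  (2 * Num.sqrt pi)^-1 * y * (Num.sqrt t) ^- 3 * expR (- (y ^+ 2 / (4 * t))).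
Proof.
move=> t0; rewrite /stable_density /= hornerX exprMn powRN2_sqr//.
rewrite powRN powR12_sqrt ?ltW//; set e := expR _; set e' := expR _.
have -> : e = e' by congr expR; field; rewrite gt_eqF.
have r0 : Num.sqrt t != 0 by rewrite gt_eqF// sqrtr_gt0.
have p0 : Num.sqrt pi != 0 :> R by rewrite gt_eqF// sqrtr_gt0 pi_gt0.
have -> : t^-1 = Num.sqrt t ^- 2 by rewrite sqr_sqrtr// ltW.
by field; rewrite r0 p0.
Qed.

Lemma continuous_stable_density0 (y t : R) : 0 < t ->
  {for t, continuous (stable_density 0 y)}.
Proof.
move=> t0; have cs := @continuous_powR R (- 2^-1) t t0.
have cys : y * s `^ (- 2^-1) @[s --> t] --> y * t `^ (- 2^-1).
  by apply: cvgM => //; exact: cvg_cst.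
apply: cvgM; first by apply: cvgM; [exact: cvg_cst|exact: cvgM].
apply: cvgM.
  apply: (@cvg_comp _ _ _ (fun s => y * s `^ (- 2^-1)) (horner (stable_poly 0))).
    exact: cys.
  exact: continuous_horner.
apply: (@continuous_comp _ _ _ (fun s => y * s `^ (- 2^-1)) (fun u => expR (- (u ^+ 2 / 4)))) => //.
apply: differentiable_continuous; apply/derivable1_diffP.
by have d := is_derive_gauss (y * t `^ (- 2^-1)); exact: ex_derive.
Qed.

Lemma cvgy_affine (c d : R) : 0 < c -> c * n.+2%:R + d @[n --> \oo] --> +oo.
Proof.
move=> c0; apply/cvgryPge => M.
have := (cvgryPge _).1 (@cvgr_idn R) ((`|M| + `|d|) / c).
move=> [N _ NP]; exists N => // n /NP /=; rewrite ler_pdivrMr// => h.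
have : n%:R * c <= n.+2%:R * c.
  by apply: ler_wpM2r; [exact: ltW|rewrite ler_nat (leq_trans (leqnSn n))].
have := ler_norm M; have := ler_norm (- d); rewrite normrN; lra.
Qed.

Lemma cvgy_affine_inv (k c d : R) : 0 < k -> 0 < c ->
  k * (c * n.+2%:R + d * n.+2%:R^-1) @[n --> \oo] --> +oo.
Proof.
move=> k0 c0; apply: ger_cvgy (@cvgy_affine _ (- (k * `|d|)) (mulr_gt0 k0 c0)).
apply: nearW => n.
rewrite -mulrA -mulrBr ler_wpM2l ?(ltW k0)// lerD2l -lerN2 opprK.
rewrite -mulNr (le_trans (ler_norm _))// normrM normrN ler_piMr//.
by rewrite ger0_norm ?invr_ge0// invf_le1 ?ler1n.
Qed.

(** For fixed t the exponent a^2/(4s) + b^2/(4(t-s)) exceeds (a+b)^2/(4t) by the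
    square of w_(-b)(s), where w_c = (2 sqrt t)^(-1) (a r + c / r) and
    r = sqrt (t/s - 1) decreases from infinity to 0 on ]0, t[.  Moreover
    w_b^2 - w_(-b)^2 is the constant ab/t, so the product of the two densities
    is the derivative of a combination of the error functions of w_(-b) and w_b. *)
Section fixed_parameters.
Variables (a b t : R).
Hypotheses (a0 : 0 < a) (b0 : 0 < b) (t0 : 0 < t).
Let r (s : R) := Num.sqrt (t * s^-1 - 1).
Let w (c s : R) := (2 * Num.sqrt t)^-1 * (a * r s + c * (r s)^-1).

Let r_gt0 s : 0 < s -> s < t -> 0 < r s.
Proof.
move=> s0 st; rewrite sqrtr_gt0 subr_gt0 -(@mulfV _ s) ?gt_eqF// ltr_pM2r//.
by rewrite invr_gt0.
Qed.

Let rE s : 0 < s -> s < t -> r s = Num.sqrt (t - s) / Num.sqrt s.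
Proof.
move=> s0 st; rewrite /r -sqrtrV ?ltW// -sqrtrM ?subr_ge0 ?ltW//.
by congr Num.sqrt; field; rewrite gt_eqF.
Qed.

Let dr s : 0 < s -> s < t -> is_derive s 1 r (- t / s ^+ 2 / (2 * r s)).
Proof.
move=> s0 st.
have s1 : s != 0 by rewrite gt_eqF.
have d1 : is_derive s 1 (fun s : R => t * s^-1 - 1) (- t / s ^+ 2).
  have d0 := @is_deriveV _ id s 1 1 s1 (is_derive_id _ _).
  have d1 := is_deriveD (is_deriveZ t d0) (is_derive_cst (-1 : R) s 1).
  move: d1; rewrite addr0 (_ : t *: _ = - t / s ^+ 2)//.
  by rewrite /GRing.scale/=; field.
have v0 : 0 < t * s^-1 - 1 by have := r_gt0 s0 st; rewrite sqrtr_gt0.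
have d2 := @is_derive1_comp _ (@Num.sqrt R) _ s _ _ (is_derive1_sqrt v0) d1.
by move: d2; rewrite mulrC.
Qed.

Let dw c s : 0 < s -> s < t ->
  is_derive s 1 (w c) ((2 * Num.sqrt t)^-1 * (a - c / r s ^+ 2) * (- t / s ^+ 2 / (2 * r s))).
Proof.
move=> s0 st; have rs0 := r_gt0 s0 st; have rn0 : r s != 0 by rewrite gt_eqF.
have d1 := dr s0 st; set dd := - t / _ / _ in d1 *.
have d2 := @is_deriveV _ r s _ 1 rn0 d1.
have := is_deriveZ (2 * Num.sqrt t)^-1 (is_deriveD (is_deriveZ a d1) (is_deriveZ c d2)).
rewrite (_ : _ *: _ = (2 * Num.sqrt t)^-1 * (a - c / r s ^+ 2) * dd)//.
have T0 : Num.sqrt t != 0 by rewrite gt_eqF// sqrtr_gt0.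
by rewrite /GRing.scale/=; field; rewrite rn0 T0.
Qed.

(* low n and up n are the points where r takes the values n + 2 and 1 / (n + 2). *)
Let low n : R := t / (1 + n.+2%:R ^+ 2).
Let up n : R := t - low n.

Let r_low n : r (low n) = n.+2%:R.
Proof.
rewrite /r -[RHS](ger0_norm (ler0n _ _)) -sqrtr_sqr; congr Num.sqrt.
by rewrite /low; field; rewrite (gt_eqF t0)/= gt_eqF// ltr_wpDr ?sqr_ge0.
Qed.

Let r_up n : r (up n) = n.+2%:R^-1.
Proof.
rewrite /r -[RHS](@ger0_norm _ n.+2%:R^-1) ?invr_ge0// -sqrtr_sqr; congr Num.sqrt.
rewrite /up /low; move: (n.+2%:R) (ltr0Sn R n.+1 : 0 < n.+2%:R) => q q0.
have q1 : 1 + q ^+ 2 != 0 by rewrite gt_eqF// ltr_wpDr ?sqr_ge0.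
have t1 : t * (1 + q ^+ 2) - t != 0.
  by rewrite mulrDr mulr1 addrAC subrr add0r mulf_neq0 ?gt_eqF// exprn_gt0.
by field; rewrite t1 q1 gt_eqF.
Qed.

Let wE (s c q : R) : r s = q -> w c s = (2 * Num.sqrt t)^-1 * (a * q + c * q^-1).
Proof. by move=> <-. Qed.

Let T0 : 0 < (2 * Num.sqrt t)^-1.
Proof. by rewrite invr_gt0 mulr_gt0// sqrtr_gt0. Qed.

Let w_low c : w c (low n) @[n --> \oo] --> +oo.
Proof.
have := cvgy_affine_inv c T0 a0; rewrite (_ : (fun n => _) = (fun n => w c (low n)))//.
by apply/funext => n; rewrite (wE c (r_low n)).
Qed.

Let w_up_pos : w b (up n) @[n --> \oo] --> +oo.
Proof.
have := cvgy_affine_inv a T0 b0; rewrite (_ : (fun n => _) = (fun n => w b (up n)))//.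
by apply/funext => n; rewrite (wE b (r_up n)) invrK addrC.
Qed.

Let w_up_neg : w (- b) (up n) @[n --> \oo] --> -oo.
Proof.
apply/cvgNry.
have := cvgy_affine_inv (- a) T0 b0.
rewrite (_ : (fun n => _) = (fun n => - w (- b) (up n)))//.
by apply/funext => n; rewrite (wE (- b) (r_up n)) invrK -mulrN opprD -!mulNr opprK addrC.
Qed.

Let low_gt0 n : 0 < low n.
Proof. by rewrite divr_gt0// ltr_wpDr ?sqr_ge0. Qed.

Let low_le_half n : low n < t / 2.
Proof.
have q2 : 1 < n.+2%:R ^+ 2 :> R by rewrite exprn_egt1// ltr1n.
rewrite /low ltr_pM2l// ltf_pV2 ?posrE//; lra.
Qed.

Let low_noninc : nonincreasing_seq low.
Proof.
move=> m n mn; rewrite /low ler_pM2l// lef_pV2 ?posrE; [|by rewrite ltr_wpDr ?sqr_ge0..].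
by rewrite lerD2l lerXn2r ?nnegrE// ler_nat.
Qed.

Let exhaustion : `]0, t[%classic = \bigcup_n `[low n, up n]%classic.
Proof.
apply/seteqP; split => x /=; rewrite in_itv/=; last first.
  move=> [n _ /=]; rewrite in_itv/= => /andP[lx xu].
  rewrite (lt_le_trans (low_gt0 n) lx)/= (le_lt_trans xu)// /up.
  by rewrite ltrBlDr ltrDl.
move=> /andP[x0 xt]; have xt0 : 0 < t - x by rewrite subr_gt0.
have h0 : 0 <= t / x + t / (t - x) by rewrite addr_ge0 ?divr_ge0 ?ltW.
have nx := archi_boundP h0; set n := Num.bound _ in nx.
have lown d : 0 < d -> t / d <= t / x + t / (t - x) -> low n <= d.
  move=> d0 td; rewrite /low ler_pdivrMr ?ltr_wpDr ?sqr_ge0// -ler_pdivrMl// mulrC.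
  apply: (le_trans td); apply: (le_trans (ltW nx)).
  have : n%:R <= n.+2%:R :> R by rewrite ler_nat (leq_trans (leqnSn n)).
  have : 0 <= n.+2%:R :> R by [].
  by nra.
exists n => //=; rewrite in_itv/= lown//; last by rewrite lerDl divr_ge0 ?ltW.
by rewrite /up lerBrDr addrC -lerBrDr lown// lerDr divr_ge0 ?ltW.
Qed.

Let w_sqr s : 0 < s -> s < t ->
  w b s ^+ 2 = w (- b) s ^+ 2 + a * b / t.
Proof.
move=> s0 st; have rn0 : r s != 0 by rewrite gt_eqF ?r_gt0.
have Tn0 : Num.sqrt t != 0 by rewrite gt_eqF// sqrtr_gt0.
have -> : t^-1 = Num.sqrt t ^- 2 by rewrite sqr_sqrtr// ltW.
by rewrite /w; field; rewrite rn0 Tn0.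
Qed.

Let w_sqr_exponent s : 0 < s -> s < t ->
  (a + b) ^+ 2 / (4 * t) + w (- b) s ^+ 2 = a ^+ 2 / (4 * s) + b ^+ 2 / (4 * (t - s)).
Proof.
move=> s0 st; have rn0 : r s != 0 by rewrite gt_eqF ?r_gt0.
have r2 : r s ^+ 2 = t / s - 1.
  by rewrite /r sqr_sqrtr// ltW//; have := r_gt0 s0 st; rewrite sqrtr_gt0.
have -> : w (- b) s ^+ 2 = (4 * t)^-1 * (a ^+ 2 * r s ^+ 2 - 2 * a * b + b ^+ 2 / r s ^+ 2).
  have -> : (4 * t)^-1 = (2 * Num.sqrt t) ^- 2.
    by rewrite exprMn sqr_sqrtr// ?ltW//; congr (_ * _)^-1; ring.
  by rewrite /w; field; rewrite rn0 gt_eqF// sqrtr_gt0.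
rewrite r2; field.
by rewrite (gt_eqF t0) (gt_eqF s0)/= subr_eq0 gt_eqF.
Qed.

(** The primitive is explicit, so only the limits of the error function at infinity
    enter the value of the integral. *)
Lemma stable_convolution :
  (\int[mu]_(s in `]0%R, t[) (stable_density 0 a s * stable_density 0 b (t - s))%:E =
   (stable_density 0 (a + b) t)%:E)%E.
Proof.
have [E [dE Emin Emax]] := @gauss_primitive R.
pose T := Num.sqrt t.
have Tn0 : T != 0 by rewrite gt_eqF// sqrtr_gt0.
have tT : t = T ^+ 2 by rewrite sqr_sqrtr// ltW.
pose P := Num.sqrt pi : R.
have Pn0 : P != 0 by rewrite gt_eqF// sqrtr_gt0 pi_gt0.
pose e0 := expR (- ((a + b) ^+ 2 / (4 * t))).
pose m := - (a * b / P ^+ 2 * T ^- 3 * e0).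
(* The derivatives of w_(-b) and w_b carry the factors a + b / r^2 and a - b / r^2;
   A and B solve A (a + b / r^2) + B (a - b / r^2) = m (1 + 1 / r^2). *)
pose A := m * (a^-1 + b^-1) / 2.
pose B := m * (a^-1 - b^-1) / 2.
pose K := expR (a * b / t).
pose G s := A * E (w (- b) s) + B * K * E (w b s).
pose f s := stable_density 0 a s * stable_density 0 b (t - s).
have S (x : R) : `]0, t[%classic x -> 0 < x /\ x < t by rewrite /= in_itv/= => /andP[].
have dG s : 0 < s -> s < t -> is_derive s 1 G (f s).
  move=> s0 st.
  have d1 := @is_derive1_comp _ E (w (- b)) s _ _ (dE _) (dw (- b) s0 st).
  have d2 := @is_derive1_comp _ E (w b) s _ _ (dE _) (dw b s0 st).
  have := is_deriveD (is_deriveZ A d1) (is_deriveZ (B * K) d2).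
  rewrite (_ : _ + _ = f s)//.
  rewrite /GRing.scale/= w_sqr// opprD expRD.
  set g := expR (- w (- b) s ^+ 2); set g' := expR (- (a * b / t)).
  have Kg : K * g' = 1 by rewrite /K /g' expRxMexpNx_1.
  have ts0 : 0 < t - s by rewrite subr_gt0.
  rewrite /f !stable_density0E//.
  set ea := expR (- (a ^+ 2 / _)); set eb := expR (- (b ^+ 2 / _)).
  have eab : ea * eb = e0 * g.
    by rewrite /ea /eb /e0 /g -!expRD -!opprD -w_sqr_exponent.
  rewrite rE// -/P -/T.
  have X0 : Num.sqrt s != 0 by rewrite gt_eqF// sqrtr_gt0.
  have Z0 : Num.sqrt (t - s) != 0 by rewrite gt_eqF// sqrtr_gt0.
  have XE : s = Num.sqrt s ^+ 2 by rewrite sqr_sqrtr// ltW.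
  have ZE : t - s = Num.sqrt (t - s) ^+ 2 by rewrite sqr_sqrtr// ltW.
  move: X0 Z0 XE ZE; set X := Num.sqrt s; set Z := Num.sqrt (t - s) => X0 Z0 XE ZE.
  have TXZ : T ^+ 2 = X ^+ 2 + Z ^+ 2 by rewrite -tT -ZE -XE addrC subrK.
  transitivity (((2 * P)^-1 ^+ 2 * a * b * X ^- 3 * Z ^- 3) * (ea * eb)); last by ring.
  rewrite eab.
  transitivity (g * m * ((1 + X ^+ 2 / Z ^+ 2) * (2 * T)^-1 * (- t / s ^+ 2 / (2 * (Z / X))))).
    transitivity (A * (g * ((2 * T)^-1 * (a - - b / (Z / X) ^+ 2) * (- t / s ^+ 2 / (2 * (Z / X))))) +
      B * ((K * g') * (g * ((2 * T)^-1 * (a - b / (Z / X) ^+ 2) * (- t / s ^+ 2 / (2 * (Z / X))))))).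
      by ring.
    rewrite Kg XE /A /B; field.
    by rewrite Z0 X0 Tn0 (gt_eqF a0) (gt_eqF b0).
  have -> : 1 + X ^+ 2 / Z ^+ 2 = T ^+ 2 / Z ^+ 2 by rewrite TXZ; field.
  rewrite XE tT /m; field.
  by rewrite Z0 X0 Tn0 Pn0.
have cvG : (G (up n) - G (low n))%:E @[n --> \oo] --> (\int[mu]_(x in `]0%R, t[) (f x)%:E)%E.
  apply: (@ge0_FTC2_exhaustion _ f G low up `]0, t[%classic).
  - move=> n; have := low_le_half n; rewrite /up; lra.
  - exact: low_noninc.
  - by move=> i j ij; rewrite lerD2l lerN2; exact: low_noninc.
  - exact: exhaustion.
  - by move=> x _; rewrite mulr_ge0// stable_density0_ge0 ?ltW.
  - move=> x /S[x0 xt]; apply: cvgM; first exact: continuous_stable_density0.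
    apply: (@continuous_comp _ _ _ (fun s => t - s) (stable_density 0 b)).
      by apply: cvgB; [exact: cvg_cst|exact: cvg_id].
    by apply: continuous_stable_density0; rewrite subr_gt0.
  - by move=> x /S[]; exact: dG.
have cvG2 : (G (up n) - G (low n))%:E @[n --> \oo] --> (A * 0 + B * K * P - (A * P + B * K * P))%:E.
  apply: cvg_EFin; first exact: nearW.
  have c1 : E (w (- b) (up n)) @[n --> \oo] --> (0 : R).
    by apply: (@cvg_comp _ _ _ (fun n => w (- b) (up n)) E); [exact: w_up_neg|exact: Emin].
  have c2 : E (w b (up n)) @[n --> \oo] --> P.
    by apply: (@cvg_comp _ _ _ (fun n => w b (up n)) E); [exact: w_up_pos|exact: Emax].
  have c3 : E (w (- b) (low n)) @[n --> \oo] --> P.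
    by apply: (@cvg_comp _ _ _ (fun n => w (- b) (low n)) E); [exact: (w_low (- b))|exact: Emax].
  have c4 : E (w b (low n)) @[n --> \oo] --> P.
    by apply: (@cvg_comp _ _ _ (fun n => w b (low n)) E); [exact: (w_low b)|exact: Emax].
  apply: cvgB; apply: cvgD.
  - by apply: cvgM; [exact: cvg_cst|exact: c1].
  - by apply: cvgM; [exact: cvg_cst|exact: c2].
  - by apply: cvgM; [exact: cvg_cst|exact: c3].
  - by apply: cvgM; [exact: cvg_cst|exact: c4].
rewrite (cvg_unique _ cvG cvG2)//; congr EFin.
rewrite stable_density0E// -/P -/T -/e0 /A /B /m; field.
by rewrite Pn0 Tn0 (gt_eqF a0) (gt_eqF b0).
Qed.

End fixed_parameters.

End subordinator_semigroup.

(** * Differentiation and interchange of integrals *)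

Section derivative_towers.
Context {R : realType}.
Implicit Types y z : R.

(** All derivatives are carried along, so that two families agree as soon as their
    members of index 0 do. *)
Definition derivative_tower (U : nat -> R -> R) : Prop :=
  forall k y, 0 < y -> is_derive y 1 (U k) (U k.+1 y).

Lemma derive1n_tower (U : nat -> R -> R) k y :
  derivative_tower U -> 0 < y -> derive1n k (U 0%N) y = U k y.
Proof.
move=> dU; elim: k y => [//|k IH] y y0.
rewrite derive1nS derive1E.
have e : {near y, derive1n k (U 0%N) =1 U k}.
  by near=> z; apply: IH; near: z; exact: lt_nbhsr.
rewrite (near_eq_derive _ e).
by have d := dU k y y0; rewrite derive_val.
Unshelve. all: by end_near. Qed.

Lemma eq_derive1n_pos (f g : R -> R) k y :
  (forall z, 0 < z -> f z = g z) -> 0 < y -> derive1n k f y = derive1n k g y.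
Proof.
move=> fg; elim: k y => [|k IH] y y0; first exact: fg.
rewrite !derive1nS !derive1E.
apply: near_eq_derive.
by near=> z; apply: IH; near: z; exact: lt_nbhsr.
Unshelve. all: by end_near. Qed.

Lemma eq_derivative_tower (U V : nat -> R -> R) k y :
  derivative_tower U -> derivative_tower V ->
  (forall z, 0 < z -> U 0%N z = V 0%N z) -> 0 < y -> U k y = V k y.
Proof.
move=> dU dV UV y0; rewrite -(derive1n_tower k dU y0) -(derive1n_tower k dV y0).
exact: eq_derive1n_pos.
Qed.

Lemma derivative_tower_shift (U : nat -> R -> R) (a : R) m : 0 <= a ->
  derivative_tower U -> derivative_tower (fun k y => U (m + k)%N (y + a)).
Proof.
move=> a0 dU k y y0.
have ya : 0 < y + a by rewrite ltr_wpDr.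
have d1 := is_deriveD (is_derive_id y 1) (is_derive_cst a y 1).
have d2 := @is_derive1_comp _ _ _ y _ _ (dU (m + k)%N _ ya) d1.
by move: d2; rewrite addr0 mulr1 addnS.
Qed.

End derivative_towers.

Section towers_under_integral.
Context {R : realType} d {Y : measurableType d} (mu : {measure set Y -> \bar R}).
Implicit Types y a x : R.
Variables (B : set Y) (F : nat -> R -> Y -> R).
Hypothesis mB : measurable B.
Hypothesis mF : forall k y, 0 < y -> measurable_fun B (F k y).
Hypothesis dF : forall k y q, 0 < y -> B q -> is_derive y 1 (F k ^~ q) (F k.+1 y q).
Hypothesis FG : forall k a, 0 < a -> exists2 G : Y -> R,
  mu.-integrable B (EFin \o G) & forall y q, a <= y -> B q -> `|F k y q| <= G q.

Lemma tower_integrable k y : 0 < y -> mu.-integrable B (EFin \o F k y).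
Proof.
move=> y0; have [G iG FGy] := FG k y0; apply: (le_integrable mB _ _ iG).
  exact/measurable_EFinP/mF.
move=> q Bq /=; rewrite lee_fin (le_trans (FGy y q (lexx y) Bq))//.
exact: ler_norm.
Qed.

(** A bound on the derivatives which is uniform on [a, oo[ for each a > 0 dominates
    the difference quotients near every y > 0. *)
Lemma derivative_tower_integral :
  derivative_tower (fun k y => \int[mu]_(q in B) F k y q).
Proof.
move=> k y y0.
have y20 : 0 < y / 2 by rewrite divr_gt0.
pose I : set R := `]y / 2, (y + 1)[%classic.
have Iy : I y by rewrite /I /= in_itv/= ltrDl ltr01 andbT; lra.
have I0 x : I x -> y / 2 <= x /\ 0 < x.
  by rewrite /I /= in_itv/= => /andP[h _]; split; [exact: ltW|exact: lt_trans h].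
have p1 x q : I x -> B q -> partial1of2 (F k) x q = F k.+1 x q.
  move=> /I0[_ x0] Bq; rewrite partial1of2E.
  by have dd := dF k x0 Bq; rewrite derive_val.
have h1 x : I x -> mu.-integrable B (EFin \o F k x).
  by move=> /I0[_ x0]; exact: tower_integrable.
have h2 x q : I x -> B q -> derivable (F k ^~ q) x 1.
  by move=> /I0[_ x0] Bq; have dd := dF k x0 Bq; exact: ex_derive.
have [G iG FGy] := FG k.+1 y20.
pose H q := `|G q|.
have h3 q : 0 <= H q by exact: normr_ge0.
have h4 : mu.-integrable B (EFin \o H).
  by have := integrable_abse iG.
have h5 x q : I x -> B q -> `|partial1of2 (F k) x q| <= H q.
  move=> Ix Bq; rewrite p1//; have [yx x0] := I0 x Ix.
  by apply: (le_trans (FGy x q yx Bq)); exact: ler_norm.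
have D := derivable_under_integral mB Iy h1 h2 h3 h4 h5.
have E := differentiation_under_integral mB Iy h1 h2 h3 h4 h5.
apply: DeriveDef; first exact: D.
rewrite -derive1E E; apply: eq_Rintegral => q; rewrite inE => Bq.
exact: p1.
Qed.

End towers_under_integral.

Section real_fubini.
Context {R : realType} d1 d2 {X : measurableType d1} {Y : measurableType d2}.
Variables (m1 : {sigma_finite_measure set X -> \bar R}) (m2 : {sigma_finite_measure set Y -> \bar R}).

Lemma measurable_Rintegral (F : X -> Y -> R) :
  measurable_fun setT (fun v : X * Y => F v.1 v.2) ->
  measurable_fun setT (fun x => \int[m2]_y F x y).
Proof.
move=> mF; apply: (measurableT_comp (fine_measurable measurableT)).
have mE : measurable_fun setT (fun v : X * Y => (F v.1 v.2)%:E) by exact/measurable_EFinP.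
rewrite (_ : (fun x => _) = (fun x =>
    fubini_F m2 (fun v => (F v.1 v.2)%:E)^\+ x - fubini_F m2 (fun v => (F v.1 v.2)%:E)^\- x)%E).
  apply: emeasurable_funB; apply: measurable_fun_fubini_tonelli_F => //.
  - exact: measurable_funepos.
  - exact: measurable_funeneg.
apply/funext => x; rewrite integralE /fubini_F.
by congr (_ - _)%E; apply: eq_integral => y _; rewrite ?funeposE ?funenegE.
Qed.

(** Integrability of all sections, and not only of almost all, keeps the infinite
    values of the inner integrals from being hidden by the real-valued integral. *)
Lemma exchange_Rintegral (F : X -> Y -> R) :
  (m1 \x m2)%E.-integrable setT (fun v => (F v.1 v.2)%:E) ->
  (forall x, m2.-integrable setT (EFin \o F x)) ->
  (forall y, m1.-integrable setT (EFin \o F ^~ y)) ->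
  \int[m1]_x \int[m2]_y F x y = \int[m2]_y \int[m1]_x F x y.
Proof.
move=> iF i2 i1; congr fine.
transitivity (\int[m1]_x \int[m2]_y (F x y)%:E)%E.
  by apply: eq_integral => x _; rewrite fineK//; apply: integrable_fin_num => //; exact: i2.
rewrite (Fubini iF); apply: eq_integral => y _.
by rewrite fineK//; apply: integrable_fin_num => //; exact: i1.
Qed.

End real_fubini.

(** * Operators with a Poisson kernel *)

Section abstract_semigroup.
Context {R : realType} d {T : measurableType d} (mu : {sigma_finite_measure set T -> \bar R}).
Notation leb := (@lebesgue_measure R).
Implicit Types (y a s : R) (p q r : T) (f g : T -> R).

(** The features of the Poisson kernel that the regularity theory uses; K k stands
    for its k-th derivative in y.  In pk_bound the case m = k expresses scaling
    and the case m > k the spectral gap. *)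
Record poisson_kernel (K : nat -> R -> T -> T -> R) : Prop := PoissonKernel {
  pk_measurable : forall k, measurable_fun setT (fun v : (R * T) * T => K k v.1.1 v.1.2 v.2);
  pk_derive : forall k y p q, 0 < y -> is_derive y 1 (fun z => K k z p q) (K k.+1 y p q);
  pk_dominated : forall k a p, 0 < a -> exists2 G : T -> R,
    mu.-integrable setT (EFin \o G) & forall y q, a <= y -> `|K k y p q| <= G q;
  pk_bound : forall k (m : R), k%:R <= m -> exists2 C : R, 0 <= C &
    forall y p, 0 < y -> (\int[mu]_q `|K k y p q|%:E <= (C * y `^ (- m))%:E)%E;
  pk_ge0 : forall y p q, 0 < y -> 0 <= K 0 y p q;
  pk_semigroup : forall a b p r, 0 < a -> 0 < b ->
    (\int[mu]_q (K 0 a p q * K 0 b q r)%:E = (K 0 (a + b) p r)%:E)%E }.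

Variable K : nat -> R -> T -> T -> R.
Hypothesis pkK : poisson_kernel K.

Definition kernel_op k y f p : R := \int[mu]_q (K k y p q * f q).
Local Notation Q := kernel_op.

Let mK k y p : measurable_fun setT (K k y p).
Proof. exact: (measurableT_comp (pk_measurable pkK k) (pair1_measurable (y, p))). Qed.

Let mK2 k y : measurable_fun setT (fun v : T * T => K k y v.1 v.2).
Proof.
apply: (measurableT_comp (pk_measurable pkK k) (f := _) (g := fun v : T * T => ((y, v.1), v.2))).
apply/measurable_fun_pairP; split; last exact: measurable_snd.
by apply/measurable_fun_pairP; split; [exact: measurable_cst|exact: measurable_fst].
Qed.

Lemma kernel_integrable k y p : 0 < y -> mu.-integrable setT (EFin \o K k y p).
Proof.
move=> y0; have [G iG KG] := pk_dominated pkK k p y0.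
apply: (le_integrable _ _ _ iG) => //; first exact/measurable_EFinP.
by move=> q _ /=; rewrite lee_fin (le_trans (KG y q (lexx y)))// ler_norm.
Qed.

Definition bounded_by (M : R) f := measurable_fun setT f /\ forall q, `|f q| <= M.

Section bounded_function.
Variables (M : R) (f : T -> R).
Hypothesis fM : bounded_by M f.

Let M0 (p : T) : 0 <= M.
Proof. by have [_ fM'] := fM; exact: le_trans (normr_ge0 _) (fM' p). Qed.

Let mf : measurable_fun setT f. Proof. by have [] := fM. Qed.

Lemma kernel_op_integrable k y p : 0 < y ->
  mu.-integrable setT (EFin \o (fun q => K k y p q * f q)).
Proof.
move=> y0; have iM : mu.-integrable setT (fun q => (M%:E * (K k y p q)%:E)%E).
  exact/integrableZl/kernel_integrable.
apply: (le_integrable _ _ _ iM) => //.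
  by apply/measurable_EFinP; exact: measurable_funM.
move=> q _ /=; rewrite lee_fin !normrM mulrC ler_wpM2r//.
by have [_ fM'] := fM; rewrite (ger0_norm (M0 p)).
Qed.

Lemma kernel_op_tower p : derivative_tower (fun k y => Q k y f p).
Proof.
apply: derivative_tower_integral => //.
- by move=> k y _; exact: measurable_funM.
- move=> k y q y0 _.
  have := is_deriveM (pk_derive pkK k p q y0) (is_derive_cst (f q) y 1).
  rewrite scaler0 add0r (_ : _ *: _ = K k.+1 y p q * f q)//.
  by rewrite /GRing.scale/= mulrC.
- move=> k a a0; have [G iG KG] := pk_dominated pkK k p a0.
  exists (fun q => M * G q).
    rewrite (_ : _ \o _ = (fun q => (M%:E * (G q)%:E)%E))//.
    exact: integrableZl.
  move=> y q ay _; rewrite normrM mulrC ler_pM//; last exact: KG.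
  by have [_ fM'] := fM.
Qed.

Lemma measurable_kernel_op2 k : measurable_fun setT (fun v : R * T => Q k v.1 f v.2).
Proof.
apply: (@measurable_Rintegral _ _ _ _ _ mu (fun (v : R * T) q => K k v.1 v.2 q * f q)).
apply: measurable_funM; first exact: pk_measurable.
by apply: measurableT_comp => //; exact: measurable_snd.
Qed.

Lemma measurable_kernel_op k y : measurable_fun setT (Q k y f).
Proof. exact: (measurableT_comp (measurable_kernel_op2 k) (pair1_measurable y)). Qed.

Lemma kernel_op_abs_le k y p : 0 < y ->
  (`|Q k y f p|%:E <= \int[mu]_q (`|K k y p q| * `|f q|)%:E)%E.
Proof.
move=> y0; have iQ := kernel_op_integrable k p y0.
rewrite EFin_normr_Rintegral//.
apply: (le_trans (le_abse_integral _ _ _)) => //.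
  by have /integrableP[] := iQ.
by under eq_integral do rewrite /= normrM.
Qed.

End bounded_function.

(** The Zygmund condition controls derivatives almost everywhere only, hence two
    bounds: M makes the integral meaningful, A is the one that is propagated. *)
Lemma kernel_op_le_ae k (m : R) : k%:R <= m -> exists2 C : R, 0 <= C &
  forall M A f, bounded_by M f -> 0 <= A -> {ae mu, forall q, `|f q| <= A} ->
  forall y p, 0 < y -> `|Q k y f p| <= C * A * y `^ (- m).
Proof.
move=> km; have [C C0 CP] := pk_bound pkK km; exists C => // M A f fM A0 fA y p y0.
rewrite -lee_fin; apply: (le_trans (kernel_op_abs_le fM k p y0)).
apply: (@le_trans _ _ (\int[mu]_q (A%:E * `|K k y p q|%:E))%E).
  apply: ae_ge0_le_integral => //.
  - by apply/measurable_EFinP/measurable_funM; apply: measurableT_comp => //; case: fM.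
  - by move=> q _; rewrite mule_ge0 ?lee_fin.
  - by apply: measurable_funeM; apply/measurable_EFinP; apply: measurableT_comp.
  - by apply: filterS fA => q fq _; rewrite -EFinM lee_fin mulrC ler_wpM2r.
rewrite ge0_integralZl//; last first.
  by apply/measurable_EFinP; apply: measurableT_comp.
rewrite (mulrC C) -mulrA EFinM lee_wpmul2l// ?lee_fin//.
exact: CP.
Qed.

Lemma kernel_op_le k (m : R) : k%:R <= m -> exists2 C : R, 0 <= C &
  forall M f, bounded_by M f -> forall y p, 0 < y -> `|Q k y f p| <= C * M * y `^ (- m).
Proof.
move=> km; have [C C0 CP] := kernel_op_le_ae km; exists C => // M f fM y p y0.
have [mf fM'] := fM; apply: (CP _ _ _ fM) => //.
  exact: le_trans (normr_ge0 _) (fM' p).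
by apply: nearW.
Qed.

Lemma kernel_op_bounded k M f y : bounded_by M f -> 0 < y ->
  exists M', bounded_by M' (Q k y f).
Proof.
move=> fM y0; have [C C0 CP] := @kernel_op_le k k%:R (lexx _).
exists (C * M * y `^ (- k%:R)); split; first exact: measurable_kernel_op fM _ _.
by move=> q; exact: CP.
Qed.

(** Fubini, with absolute convergence because the composition of the two kernels is
    the kernel at a + b, which is integrable. *)
Lemma kernel_op_semigroup0 M f a b p : bounded_by M f -> 0 < a -> 0 < b ->
  Q 0 a (Q 0 b f) p = Q 0 (a + b) f p.
Proof.
move=> fM a0 b0; have [mf fM'] := fM.
have M0 : 0 <= M by exact: le_trans (normr_ge0 _) (fM' p).
have mKK : measurable_fun setT (fun v : T * T => K 0 a p v.1 * (K 0 b v.1 v.2 * f v.2)).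
  apply: measurable_funM; first exact: (measurableT_comp (mK 0 a p) measurable_fst).
  apply: measurable_funM; first exact: mK2.
  exact: (measurableT_comp mf measurable_snd).
have KK r : (\int[mu]_q `|(K 0 a p q * (K 0 b q r * f r))%:E|)%E = (`|f r| * K 0 (a + b) p r)%:E.
  rewrite EFinM -(pk_semigroup pkK _ _ a0 b0) -ge0_integralZl//; last 2 first.
  - apply/measurable_EFinP; apply: measurable_funM => //.
    exact: (measurableT_comp (mK2 0 b) (pair2_measurable r)).
  - by move=> q _; rewrite lee_fin mulr_ge0// (pk_ge0 pkK).
  apply: eq_integral => q _; rewrite -EFinM abse_EFin !normrM.
  by rewrite (ger0_norm (pk_ge0 pkK _ _ a0)) (ger0_norm (pk_ge0 pkK _ _ b0)) mulrA mulrC.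
have iKK r : mu.-integrable setT (EFin \o (fun q => K 0 a p q * (K 0 b q r * f r))).
  apply/integrableP; split; last by rewrite KK ltry.
  apply/measurable_EFinP; apply: measurable_funM => //; apply: measurable_funM => //.
  exact: (measurableT_comp (mK2 0 b) (pair2_measurable r)).
transitivity (\int[mu]_q \int[mu]_r (K 0 a p q * (K 0 b q r * f r))).
  apply: eq_Rintegral => q _; rewrite RintegralZl//.
  exact: kernel_op_integrable fM _ _ _ b0.
rewrite (exchange_Rintegral (m1 := mu) (m2 := mu)
  (F := fun q r => K 0 a p q * (K 0 b q r * f r)))//.
- apply: eq_Rintegral => r _.
  transitivity (\int[mu]_q (K 0 a p q * K 0 b q r * f r)).
    by apply: eq_Rintegral => q _; rewrite mulrA.
  have iab : mu.-integrable setT (EFin \o (fun q => K 0 a p q * K 0 b q r)).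
    apply/integrableP; split.
      apply/measurable_EFinP; apply: measurable_funM => //.
      exact: (measurableT_comp (mK2 0 b) (pair2_measurable r)).
    under eq_integral do rewrite /= ger0_norm ?mulr_ge0 ?(pk_ge0 pkK)//.
    by rewrite (pk_semigroup pkK)// ltry.
  by rewrite RintegralZr// /Rintegral (pk_semigroup pkK).
- have mE : measurable_fun setT (fun v : T * T => (K 0 a p v.1 * (K 0 b v.1 v.2 * f v.2))%:E).
    exact/measurable_EFinP.
  have [_] := @integrable21ltyP _ _ _ _ _ mu mu _ mE; apply.
  under eq_integral do rewrite KK.
  apply: (@le_lt_trans _ _ (\int[mu]_r (M%:E * (`|K 0 (a + b) p r|)%:E))%E).
    apply: ge0_le_integral => //.
    - by move=> r _; rewrite lee_fin mulr_ge0// (pk_ge0 pkK)// addr_gt0.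
    - apply/measurable_EFinP; apply: measurable_funM => //.
      exact: measurableT_comp.
    - by apply: measurable_funeM; apply/measurable_EFinP; exact: measurableT_comp.
    - by move=> r _; rewrite -EFinM lee_fin ler_pM// ?(pk_ge0 pkK) ?addr_gt0// ler_norm.
  have /integrableP[_] : mu.-integrable setT (fun r => (M%:E * (K 0 (a + b) p r)%:E)%E).
    by apply/integrableZl/kernel_integrable; rewrite ?addr_gt0.
  by under eq_integral do rewrite abseM abse_EFin (ger0_norm M0) abse_EFin.
- move=> q; rewrite (_ : _ \o _ = (fun r => ((K 0 a p q)%:E * (K 0 b q r * f r)%:E)%E))//.
  exact/integrableZl/(kernel_op_integrable fM 0 q b0).
Qed.

(** Both sides are families of derivatives, first in b and then in a, so the law
    follows from its case m = k = 0. *)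
Lemma kernel_op_semigroup M f m k a b p : bounded_by M f -> 0 < a -> 0 < b ->
  Q m a (Q k b f) p = Q (m + k) (a + b) f p.
Proof.
move=> fM a0 b0.
have step1 y : 0 < y -> Q 0 y (Q k b f) p = Q k (y + b) f p.
  move=> y0; pose U j z := Q 0 y (Q j z f) p.
  pose V j z := Q (0 + j) (z + y) f p.
  have := @eq_derivative_tower _ U V k b _ _ _ b0.
  rewrite /U /V add0n (addrC b); apply.
  - apply: derivative_tower_integral => //.
    + move=> j z z0; apply: measurable_funM => //; exact: measurable_kernel_op fM _ _.
    + move=> j z q z0 _.
      have := is_deriveM (is_derive_cst (K 0 y p q) z 1) (kernel_op_tower fM q j z0).
      by rewrite scaler0 addr0.
    + move=> j c c0; have [C C0 CP] := @kernel_op_le j j%:R (lexx _).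
      exists (fun q => (C * M * c `^ (- j%:R)) * `|K 0 y p q|).
        rewrite (_ : _ \o _ = (fun q => ((C * M * c `^ (- j%:R))%:E * `|(K 0 y p q)%:E|)%E))//.
        exact/integrableZl/integrable_abse/kernel_integrable.
      move=> z q cz _; rewrite normrM mulrC ler_wpM2r//.
      apply: (le_trans (CP _ _ fM z q (lt_le_trans c0 cz))).
      have M0 : 0 <= M by have [_ fM'] := fM; exact: le_trans (normr_ge0 _) (fM' q).
      by rewrite ler_wpM2l ?mulr_ge0// ler_powRN.
  - by apply: derivative_tower_shift (kernel_op_tower fM p); exact: ltW.
  - by move=> z z0; rewrite (addrC z); apply: kernel_op_semigroup0 fM _ _.
have [M' gM'] := kernel_op_bounded k fM b0.
pose U j z := Q j z (Q k b f) p.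
pose V j z := Q (k + j) (z + b) f p.
have h := @eq_derivative_tower _ U V m a _ _ _ a0.
rewrite (addnC m); apply: h.
- exact: kernel_op_tower gM' p.
- by apply: derivative_tower_shift (kernel_op_tower fM p); exact: ltW.
- by move=> z z0; rewrite /U /V addn0; exact: step1.
Qed.

End abstract_semigroup.

(** * Potentials of bounded functions *)

Lemma powRD_gt0 {R : realType} (x r s : R) : 0 < x -> x `^ (r + s) = x `^ r * x `^ s.
Proof. by move=> x0; rewrite powRD// (gt_eqF x0) implybT. Qed.

Section potential.
Context {R : realType} d {T : measurableType d} (mu : {sigma_finite_measure set T -> \bar R}).
Notation leb := (@lebesgue_measure R).
Implicit Types (y a s m : R) (p q r : T) (f g : T -> R).
Variable K : nat -> R -> T -> T -> R.
Hypothesis pkK : poisson_kernel mu K.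
Local Notation Q := (kernel_op mu K).
Variable beta : R.
Hypothesis beta_gt0 : 0 < beta.
Local Notation D := (`]0%R, +oo[%classic : set R).

Let D0 s : D s -> 0 < s. Proof. by rewrite /= in_itv/= andbT. Qed.

(** The negative power of order beta without its factor 1 / Gamma(2 beta). *)
Definition potential f p : R :=
  \int[leb]_(s in `]0%R, +oo[) (Q 0 s f p * s `^ (2 * beta - 1)).

Lemma measurable_weight m y : measurable_fun D (fun s => s `^ (2 * beta - 1) * (y + s) `^ (- m)).
Proof.
apply: measurable_funTS; apply: measurable_funM; first exact: measurable_powR.
by apply: (measurableT_comp (measurable_powR _)); exact: measurable_funD.
Qed.

(** The kernel bound of order beta for s <= 1 and of order 3 beta for s > 1 leave
    s^(beta - 1) and s^(-beta - 1): the potential converges at both ends. *)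
Lemma kernel_op_weight_le : exists2 C : R, 0 <= C &
  forall M f, bounded_by M f -> forall s p, 0 < s ->
    `|Q 0 s f p * s `^ (2 * beta - 1)| <= C * M * (s `^ (beta - 1) * (1 + s) `^ (- (2 * beta))).
Proof.
have [C1 C10 CP1] := kernel_op_le pkK (k := 0) (ltW beta_gt0).
have b3 : (0%:R : R) <= 3 * beta by rewrite mulr_ge0// ltW.
have [C3 C30 CP3] := kernel_op_le pkK b3.
exists (2 `^ (2 * beta) * (C1 + C3)); first by rewrite mulr_ge0 ?powR_ge0 ?addr_ge0.
move=> M f fM s p s0; have [_ fM'] := fM.
have M0 : 0 <= M by exact: le_trans (normr_ge0 _) (fM' p).
rewrite normrM (ger0_norm (powR_ge0 _ _)).
have e2 : 0 <= 2 * beta by rewrite mulr_ge0// ltW.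
have two c : 0 < c -> 1 <= 2 `^ (2 * beta) * (2 * c) `^ (- (2 * beta)) * c `^ (2 * beta).
  move=> c0; rewrite powRM ?(ltW c0)// mulrA -powRD_gt0// subrr powRr0 mul1r.
  by rewrite -powRD_gt0// addrC subrr powRr0.
have [s1|s1] := lerP s 1.
  apply: (@le_trans _ _ (C1 * M * (s `^ (- beta) * s `^ (2 * beta - 1)))).
    by rewrite mulrA ler_wpM2r ?powR_ge0//; exact: CP1.
  rewrite -powRD_gt0//.
  rewrite (_ : - beta + (2 * beta - 1) = beta - 1); last by ring.
  rewrite [leRHS](_ : _ = (C1 + C3) * M * (s `^ (beta - 1) * (2 `^ (2 * beta) * (1 + s) `^ (- (2 * beta))))); last by ring.
  apply: ler_pM; rewrite ?mulr_ge0 ?powR_ge0//; first by rewrite ler_wpM2r// lerDl.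
  rewrite ler_peMr ?powR_ge0//.
  have := two 1 ltr01; rewrite mulr1 powR1 mulr1 => /le_trans; apply.
  by rewrite ler_wpM2l ?powR_ge0// ler_powRN// ?addr_gt0//; lra.
apply: (@le_trans _ _ (C3 * M * (s `^ (- (3 * beta)) * s `^ (2 * beta - 1)))).
  by rewrite mulrA ler_wpM2r ?powR_ge0//; exact: CP3.
rewrite -powRD_gt0//.
rewrite (_ : - (3 * beta) + (2 * beta - 1) = (beta - 1) + - (2 * beta)); last by ring.
rewrite powRD_gt0//.
rewrite [leRHS](_ : _ = (C1 + C3) * M * (s `^ (beta - 1) * (2 `^ (2 * beta) * (1 + s) `^ (- (2 * beta))))); last by ring.
apply: ler_pM; rewrite ?mulr_ge0 ?powR_ge0//; first by rewrite ler_wpM2r// lerDr.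
rewrite ler_wpM2l ?powR_ge0//.
rewrite powRN -[leLHS]mul1r ler_pdivrMr ?powR_gt0//.
apply: (le_trans (two s s0)); rewrite ler_wpM2r ?powR_ge0// ler_wpM2l ?powR_ge0//.
by rewrite ler_powRN// ?addr_gt0//; lra.
Qed.

Let weight_integrable (C g m : R) : 0 < g -> g < m ->
  forall y, 0 < y -> leb.-integrable D (fun s => (C * (s `^ (g - 1) * (y + s) `^ (- m)))%:E).
Proof.
move=> g0 gm y y0; have [B B0 BP] := integral_powR_powRD_le g0 gm.
rewrite (_ : (fun s => _) = (fun s => (C%:E * (s `^ (g - 1) * (y + s) `^ (- m))%:E)%E))//.
apply: integrableZl => //; apply/integrableP; split.
  apply/measurable_EFinP; apply: measurable_funTS; apply: measurable_funM; first exact: measurable_powR.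
  by apply: (measurableT_comp (measurable_powR _)); exact: measurable_funD.
under eq_integral do rewrite /= ger0_norm ?mulr_ge0 ?powR_ge0//.
by apply: (le_lt_trans (BP y y0)); rewrite ltry.
Qed.

Let bb : beta < 2 * beta. Proof. by rewrite ltr_pMl// ltr1n. Qed.

Lemma potential_integrable M f p : bounded_by M f ->
  leb.-integrable D (EFin \o (fun s => Q 0 s f p * s `^ (2 * beta - 1))).
Proof.
move=> fM; have [C C0 CP] := kernel_op_weight_le.
apply: (le_integrable _ _ _ (weight_integrable (C * M) beta_gt0 bb ltr01)) => //.
  apply/measurable_EFinP; apply: measurable_funTS; apply: measurable_funM; last exact: measurable_powR.
  exact: (measurableT_comp (measurable_kernel_op2 pkK fM 0) (pair2_measurable p)).
move=> s /D0 s0 /=; rewrite lee_fin; apply: (le_trans (CP _ _ fM s p s0)).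
exact: ler_norm.
Qed.

(** Extension by zero, so that Fubini applies on the full product space. *)
Let integrand f p s : R := (Q 0 s f p * s `^ (2 * beta - 1)) * \1_D s.

Let potentialE f p : potential f p = \int[leb]_s integrand f p s.
Proof.
rewrite /potential Rintegral_mkcond; apply: eq_Rintegral => s _.
by rewrite patch_indic.
Qed.

Let measurable_integrand M f : bounded_by M f ->
  measurable_fun setT (fun v : T * R => integrand f v.1 v.2).
Proof.
move=> fM; apply: measurable_funM; last first.
  by apply: measurableT_comp => //; exact: measurable_snd.
apply: measurable_funM; last first.
  by apply: (measurableT_comp (measurable_powR _)); exact: measurable_snd.
exact: (measurableT_comp (measurable_kernel_op2 pkK fM 0) (@measurable_swap _ _ T R)).
Qed.

Let integrand_integrable M f p : bounded_by M f ->
  leb.-integrable setT (EFin \o integrand f p).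
Proof.
move=> fM; have /(integrable_mkcond _ _).1 := potential_integrable p fM.
move=> /(_ (measurable_itv _)); rewrite restrict_EFin.
by apply: eq_integrable => // s _ /=; rewrite patch_indic.
Qed.

Lemma potential_abs_le : exists2 C : R, 0 <= C & forall M f p, bounded_by M f ->
  (\int[leb]_(s in `]0%R, +oo[) `|Q 0 s f p * s `^ (2 * beta - 1)|%:E <= (C * M)%:E)%E.
Proof.
have [C C0 CP] := kernel_op_weight_le.
have [B B0 BP] := integral_powR_powRD_le beta_gt0 bb.
exists (C * B); first exact: mulr_ge0.
move=> M f p fM; have [_ fM'] := fM.
have M0 : 0 <= M by exact: le_trans (normr_ge0 _) (fM' p).
have iP := potential_integrable p fM.
have mW : measurable_fun D (fun s => (s `^ (beta - 1) * (1 + s) `^ (- (2 * beta)))%:E).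
  apply/measurable_EFinP; apply: measurable_funTS.
  apply: measurable_funM; first exact: measurable_powR.
  by apply: (measurableT_comp (measurable_powR _)); exact: measurable_funD.
apply: (@le_trans _ _ (\int[leb]_(s in D) ((C * M)%:E * (s `^ (beta - 1) * (1 + s) `^ (- (2 * beta)))%:E))%E).
  apply: ge0_le_integral => //.
  - apply/measurable_EFinP; apply: measurableT_comp => //.
    by have /integrableP[/measurable_EFinP] := iP.
  - exact: measurable_funeM.
  - by move=> s /D0 s0; rewrite -EFinM lee_fin; exact: CP.
rewrite ge0_integralZl//; last 2 first.
- by move=> s _; rewrite lee_fin mulr_ge0 ?powR_ge0.
- by rewrite lee_fin mulr_ge0.
have := BP 1 ltr01; rewrite powR1 mulr1 => h.
rewrite (_ : C * B * M = (C * M) * B); last by ring.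
by rewrite [leRHS]EFinM lee_wpmul2l// lee_fin mulr_ge0.
Qed.

Lemma potential_bounded : exists2 C : R, 0 <= C &
  forall M f, bounded_by M f -> bounded_by (C * M) (potential f).
Proof.
have [C C0 CP] := potential_abs_le; exists C => // M f fM; split.
  rewrite (_ : potential f = fun p => \int[leb]_s integrand f p s); last first.
    by apply/funext => p; exact: potentialE.
  exact: (measurable_Rintegral leb (measurable_integrand fM)).
move=> p; have iP := potential_integrable p fM.
rewrite -lee_fin /potential EFin_normr_Rintegral//.
apply: (le_trans (le_abse_integral _ _ _)) => //; first by have /integrableP[] := iP.
exact: CP.
Qed.

(** Fubini and the semigroup law for kernels of index 0. *)
Let kernel_op_potential0 M f y p : bounded_by M f -> 0 < y ->
  Q 0 y (potential f) p = \int[leb]_(s in D) (Q 0 (y + s) f p * s `^ (2 * beta - 1)).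
Proof.
move=> fM y0.
have mKI : measurable_fun setT (fun v : T * R => K 0 y p v.1 * integrand f v.1 v.2).
  apply: measurable_funM; last exact: measurable_integrand fM.
  have mK : measurable_fun setT (K 0 y p).
    by have /integrableP[/measurable_EFinP] := kernel_integrable pkK 0 p y0.
  exact: (measurableT_comp mK (@measurable_fst _ _ T R)).
have [C C0 CP] := potential_abs_le.
transitivity (\int[mu]_q \int[leb]_s (K 0 y p q * integrand f q s)).
  apply: eq_Rintegral => q _; rewrite potentialE RintegralZl//.
  exact: integrand_integrable fM.
rewrite (exchange_Rintegral (m1 := mu) (m2 := leb) (F := fun q s => K 0 y p q * integrand f q s)).
- rewrite [RHS]Rintegral_mkcond; apply: eq_Rintegral => s _.
  rewrite patch_indic/=; have [sD|sD] := boolP (s \in D); last first.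
    rewrite /integrand indicE (negbTE sD) mulr0.
    by under eq_Rintegral do rewrite mulr0 mulr0; rewrite Rintegral_cst// mul0r.
  have s0 : 0 < s by apply: D0; exact: set_mem.
  rewrite -(kernel_op_semigroup0 pkK p fM y0 s0) /integrand indicE sD mulr1.
  under eq_Rintegral do rewrite mulr1 mulrA.
  rewrite RintegralZr//.
  have [M' gM'] := kernel_op_bounded pkK 0 fM s0.
  exact: (kernel_op_integrable pkK gM' 0 p y0).
- have mE : measurable_fun setT (fun v : T * R => (K 0 y p v.1 * integrand f v.1 v.2)%:E).
    exact/measurable_EFinP.
  have [_] := @integrable12ltyP _ _ _ _ _ mu leb _ mE; apply.
  have [_ fM'] := fM.
  have M0 : 0 <= M by exact: le_trans (normr_ge0 _) (fM' p).
  have CM0 : 0 <= C * M by exact: mulr_ge0.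
  have mK : measurable_fun setT (EFin \o K 0 y p).
    by have /integrableP[] := kernel_integrable pkK 0 p y0.
  have mI q : measurable_fun setT (integrand f q).
    by have /integrableP[/measurable_EFinP] := integrand_integrable q fM.
  apply: (@le_lt_trans _ _ (\int[mu]_q ((C * M)%:E * `|(K 0 y p q)%:E|))%E); last first.
    rewrite ge0_integralZl//; last exact: measurableT_comp.
    have /integrableP[_ h] := kernel_integrable pkK 0 p y0.
    by rewrite lte_mul_pinfty// lee_fin.
  apply: ge0_le_integral => //.
  - by move=> q _; exact: integral_ge0.
  - apply: (@measurable_fun_fubini_tonelli_F _ _ _ _ _ leb
      (fun v : T * R => `|(K 0 y p v.1 * integrand f v.1 v.2)%:E|%E)) => //.
    exact: measurableT_comp.
  - by apply: measurable_funeM; exact: measurableT_comp.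
  move=> q _.
  rewrite (_ : integral _ _ _ = `|(K 0 y p q)%:E| * \int[leb]_s `|(integrand f q s)%:E|)%E; last first.
    rewrite -ge0_integralZl//; first by apply: eq_integral => s _; rewrite /= normrM EFinM.
    apply: (@measurableT_comp _ _ _ _ _ _ abse) => //.
    by have /integrableP[] := integrand_integrable q fM.
  rewrite muleC lee_wpmul2r//; apply: le_trans (CP _ _ q fM).
  rewrite [leRHS]integral_mkcond; rewrite le_eqVlt; apply/orP; left; apply/eqP.
  apply: eq_integral => s _; rewrite /integrand patchE indicE.
  by case: ifPn => sD; [rewrite mulr1|rewrite mulr0 abse0].
- by move=> q; rewrite (_ : _ \o _ = (fun s => ((K 0 y p q)%:E * (integrand f q s)%:E)%E))//;
    apply: integrableZl => //; exact: integrand_integrable fM.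
- move=> s; have [sD|sD] := boolP (s \in D); last first.
    rewrite (_ : _ \o _ = cst 0); first exact: integrable0.
    by apply/funext => q /=; rewrite /integrand indicE (negbTE sD) !mulr0.
  have s0 : 0 < s by apply: D0; exact: set_mem.
  have [M' gM'] := kernel_op_bounded pkK 0 fM s0.
  have := kernel_op_integrable pkK gM' 0 p y0.
  move=> /(integrableZl measurableT (s `^ (2 * beta - 1))).
  apply: eq_integrable => // q _ /=.
  by rewrite /integrand indicE sD mulr1 -EFinM mulrA mulrC.
Qed.

Let dominated_shift l m M f : bounded_by M f -> l%:R <= m -> 2 * beta < m ->
  forall p a, 0 < a -> exists2 G : R -> R, leb.-integrable D (EFin \o G) &
    forall y s, a <= y -> D s -> `|Q l (y + s) f p * s `^ (2 * beta - 1)| <= G s.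
Proof.
move=> fM lm bm p a a0; have [C C0 CP] := kernel_op_le pkK lm.
have [_ fM'] := fM.
have M0 : 0 <= M by exact: le_trans (normr_ge0 _) (fM' p).
have b20 : 0 < 2 * beta by rewrite mulr_gt0.
exists (fun s => C * M * (s `^ (2 * beta - 1) * (a + s) `^ (- m))).
  exact: weight_integrable b20 bm _ a0.
move=> y s ay /D0 s0; have as0 : 0 < a + s by rewrite addr_gt0.
have asy : a + s <= y + s by rewrite lerD2r.
rewrite normrM (ger0_norm (powR_ge0 _ _)) [in leRHS]mulrCA mulrC ler_wpM2l ?powR_ge0//.
apply: (le_trans (CP _ _ fM _ p (lt_le_trans as0 asy))).
rewrite ler_wpM2l ?mulr_ge0// ler_powRN// (le_trans _ (ltW bm))// ltW//.
Qed.

(** Both sides are families of derivatives in y, and they agree for l = 0. *)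
Lemma kernel_op_potential l M f y p : bounded_by M f -> 0 < y ->
  Q l y (potential f) p = \int[leb]_(s in D) (Q l (y + s) f p * s `^ (2 * beta - 1)).
Proof.
move=> fM y0; have [C C0 CP] := potential_bounded.
pose V j z := \int[leb]_(s in D) (Q j (z + s) f p * s `^ (2 * beta - 1)).
apply: (@eq_derivative_tower _ (fun j z => Q j z (potential f) p) V) => //.
- exact: (kernel_op_tower pkK (CP _ _ fM) p).
- apply: derivative_tower_integral => //.
  + move=> k z z0; apply: measurable_funTS; apply: measurable_funM; last exact: measurable_powR.
    apply: (measurableT_comp (measurableT_comp (measurable_kernel_op2 pkK fM k) (pair2_measurable p))
      (g := fun s : R => z + s)).
    exact: measurable_funD.
  + move=> k z s z0 /D0 s0.
    have d1 := derivative_tower_shift 0 (ltW s0) (kernel_op_tower pkK fM p) k z0.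
    have := is_deriveM d1 (is_derive_cst (s `^ (2 * beta - 1)) z 1).
    rewrite scaler0 add0r (_ : _ *: _ = Q k.+1 (z + s) f p * s `^ (2 * beta - 1))//.
    by rewrite /GRing.scale/= mulrC.
  + move=> k a a0; apply: (dominated_shift (m := k%:R + (2 * beta + 1)) fM) => //.
      by rewrite lerDl addr_ge0// mulr_ge0// ltW.
    by rewrite addrCA ltrDl ltr_wpDl.
- by move=> z z0; exact: kernel_op_potential0 fM z0.
Qed.

(** The gain of 2 beta in regularity: it is the gain of exponent in the integral of
    (y + s)^(-m) s^(2 beta - 1). *)
Lemma kernel_op_potential_le m : 2 * beta < m -> exists2 C : R, 0 <= C &
  forall l M f A p, bounded_by M f -> 0 <= A ->
    (forall s, 0 < s -> `|Q l s f p| <= A * s `^ (- m)) ->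
    forall y, 0 < y -> `|Q l y (potential f) p| <= C * A * y `^ (2 * beta - m).
Proof.
move=> bm; have b20 : 0 < 2 * beta by rewrite mulr_gt0.
have [B B0 BP] := integral_powR_powRD_le b20 bm.
exists B => // l M f A p fM A0 QA y y0.
rewrite (kernel_op_potential _ _ fM y0).
have mQ : measurable_fun D (fun s => Q l (y + s) f p * s `^ (2 * beta - 1)).
  apply: measurable_funTS; apply: measurable_funM; last exact: measurable_powR.
  apply: (measurableT_comp (measurableT_comp (measurable_kernel_op2 pkK fM l) (pair2_measurable p))
    (g := fun s : R => y + s)).
  exact: measurable_funD.
have key s : D s -> `|Q l (y + s) f p * s `^ (2 * beta - 1)| <=
    A * (s `^ (2 * beta - 1) * (y + s) `^ (- m)).
  move=> /D0 s0; rewrite normrM (ger0_norm (powR_ge0 _ _)) mulrCA mulrC.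
  by rewrite ler_wpM2l ?powR_ge0// QA// addr_gt0.
have iQ : leb.-integrable D (EFin \o (fun s => Q l (y + s) f p * s `^ (2 * beta - 1))).
  apply: (le_integrable _ _ _ (weight_integrable A b20 bm y0)) => //.
    exact/measurable_EFinP.
  by move=> s Ds /=; rewrite lee_fin (le_trans (key s Ds))// ler_norm.
rewrite -lee_fin EFin_normr_Rintegral//.
apply: (le_trans (le_abse_integral _ _ _)) => //; first exact/measurable_EFinP.
apply: (@le_trans _ _ (\int[leb]_(s in D) (A%:E * (s `^ (2 * beta - 1) * (y + s) `^ (- m))%:E))%E).
  apply: ge0_le_integral => //.
  - by apply: measurableT_comp => //; exact/measurable_EFinP.
  - by apply: measurable_funeM; apply/measurable_EFinP; exact: measurable_weight.
rewrite ge0_integralZl//; last 2 first.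
- by apply/measurable_EFinP; exact: measurable_weight.
- by move=> s _; rewrite lee_fin mulr_ge0 ?powR_ge0.
rewrite (mulrC B) -mulrA [leRHS]EFinM lee_wpmul2l// ?lee_fin//.
exact: BP.
Qed.

End potential.

(** * Essential bounds and Zygmund seminorms *)

Section essential_bounds.
Context {R : realType} d {T : measurableType d} (mu : {measure set T -> \bar R}).
Implicit Types f g : T -> R.

Lemma LinftyP f : Linfty mu f <-> measurable_fun setT f /\ (Linfty_norm mu f < +oo)%E.
Proof.
rewrite /Linfty /= /Lfun; split.
  by move=> /andP[/set_mem mf /set_mem nf].
by move=> [mf nf]; apply/andP; split; rewrite inE.
Qed.

Lemma Linfty_norm_ge0 f : (0 <= Linfty_norm mu f)%E.
Proof. exact: Lnorm_ge0. Qed.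

Lemma Linfty_norm_le f (c : R) : 0 <= c -> (forall p, `|f p| <= c) ->
  (Linfty_norm mu f <= c%:E)%E.
Proof.
move=> c0 fc; rewrite /Linfty_norm unlock; case: ifP => _; last by rewrite lee_fin.
by apply/ess_supP; apply: nearW => p /=; rewrite lee_fin.
Qed.

Lemma Linfty_norm_ae f : {ae mu, forall p, (`|f p|%:E <= Linfty_norm mu f)%E}.
Proof.
rewrite /Linfty_norm unlock; case: ifPn => muT; first exact: ess_sup_ge.
exists setT; split => //; apply/eqP; rewrite -measure_le0 leNgt//.
Qed.

(** Truncation at the essential supremum selects in each class of essentially
    bounded functions a representative that is bounded everywhere. *)
Definition clip (M x : R) : R := Num.max (- M) (Num.min x M).

Lemma clip_le M x : 0 <= M -> `|clip M x| <= M.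
Proof.
move=> M0; rewrite ler_norml /clip le_max lexx/= ge_max ge_min lexx orbT andbT.
by rewrite (le_trans _ M0)// oppr_le0.
Qed.

Lemma clip_id M x : `|x| <= M -> clip M x = x.
Proof. by rewrite ler_norml => /andP[h1 h2]; rewrite /clip min_l// max_r. Qed.

Lemma bounded_clip M f : 0 <= M -> measurable_fun setT f ->
  bounded_by M (fun p => clip M (f p)).
Proof.
move=> M0 mf; split; last by move=> q; exact: clip_le.
by apply: measurable_maxr => //; exact: measurable_minr.
Qed.

Lemma bounded_Linfty M f : bounded_by M f -> 0 <= M -> Linfty mu f.
Proof.
move=> [mf fM] M0; apply/LinftyP; split => //.
by apply: (le_lt_trans (Linfty_norm_le M0 fM)); rewrite ltry.
Qed.

Lemma zygmund_bounds_ge0 (P : R -> (T -> R) -> T -> R) alpha f A :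
  zygmund_bounds mu P alpha f A -> 0 <= A.
Proof.
move=> /(_ 1 ltr01); rewrite powR1 mulr1 => h.
by rewrite -lee_fin (le_trans _ h)// Linfty_norm_ge0.
Qed.

Lemma ereal_inf_zygmund_bounds_ge0 (P : R -> (T -> R) -> T -> R) alpha f :
  (0 <= ereal_inf [set x%:E | x in zygmund_bounds mu P alpha f])%E.
Proof.
by apply: le_ereal_inf_tmp => _ [x Sx <-]; rewrite lee_fin; exact: zygmund_bounds_ge0 Sx.
Qed.

Lemma Lambda_norm_ge0 (P : R -> (T -> R) -> T -> R) alpha f :
  (0 <= Lambda_norm mu P alpha f)%E.
Proof. by rewrite adde_ge0 ?Linfty_norm_ge0 ?ereal_inf_zygmund_bounds_ge0. Qed.

End essential_bounds.

Section ereal_infima.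
Context {R : realType}.

Lemma ereal_inf_scale (S S' : set R) (B : R) : 0 < B ->
  (forall x, S x -> S' (B * x)) ->
  (ereal_inf [set x%:E | x in S'] <= B%:E * ereal_inf [set x%:E | x in S])%E.
Proof.
move=> B0 SS; rewrite -lee_pdivrMl//; apply: le_ereal_inf_tmp => _ [x Sx <-].
rewrite lee_pdivrMl// -EFinM; apply: ereal_inf_lbound.
by exists (B * x) => //; exact: SS.
Qed.

End ereal_infima.

(** * Regularity of negative powers for an abstract Poisson kernel *)

Section zygmund_potential.
Context {R : realType} d {T : measurableType d} (mu : {sigma_finite_measure set T -> \bar R}).
Implicit Types f g : T -> R.
Variable K : nat -> R -> T -> T -> R.
Hypothesis pkK : poisson_kernel mu K.
Local Notation Q := (kernel_op mu K).
(** The semigroup enters through its defining formula, which agrees with the kernel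
    operator where that formula is an absolutely convergent integral. *)
Variable P : R -> (T -> R) -> T -> R.
Hypothesis PQ : forall y f p, 0 < y -> Linfty mu f -> P y f p = Q 0 y f p.

Lemma kernel_op_ae_eq k y f g p : 0 < y -> measurable_fun setT f -> measurable_fun setT g ->
  {ae mu, forall q, f q = g q} -> Q k y f p = Q k y g p.
Proof.
move=> y0 mf mg fg; congr fine; apply: ae_eq_integral => //.
- apply/measurable_EFinP; apply: measurable_funM => //.
  by have /integrableP[/measurable_EFinP] := kernel_integrable pkK k p y0.
- apply/measurable_EFinP; apply: measurable_funM => //.
  by have /integrableP[/measurable_EFinP] := kernel_integrable pkK k p y0.
- by apply: filterS fg => q -> _.
Qed.

Let M f := fine (Linfty_norm mu f).
Let t f p := clip (M f) (f p).

Let M_ge0 f : 0 <= M f. Proof. by rewrite fine_ge0// Linfty_norm_ge0. Qed.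

Let ME f : Linfty mu f -> Linfty_norm mu f = (M f)%:E.
Proof.
by move=> /LinftyP[_ nf]; rewrite fineK// ge0_fin_numE// Linfty_norm_ge0.
Qed.

Let tM f : Linfty mu f -> bounded_by (M f) (t f).
Proof. by move=> /LinftyP[mf _]; exact: bounded_clip. Qed.

Let tQ f k y p : Linfty mu f -> 0 < y -> Q k y f p = Q k y (t f) p.
Proof.
move=> fL y0; have [mf _] := (LinftyP mu f).1 fL; have [mt _] := tM fL.
apply: kernel_op_ae_eq => //; have := Linfty_norm_ae mu f.
by apply: filterS => q; rewrite (ME fL) lee_fin => h; rewrite /t clip_id.
Qed.

Let derive_P f k y p : Linfty mu f -> 0 < y ->
  derive1n k (fun s : R => P s f p) y = Q k y (t f) p.
Proof.
move=> fL y0; rewrite -(derive1n_tower k (kernel_op_tower pkK (tM fL) p) y0).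
by apply: eq_derive1n_pos => // s s0; rewrite PQ// tQ.
Qed.

Variable beta : R.
Hypothesis beta_gt0 : 0 < beta.
Let c : R := (Gamma (2 * beta))^-1.
Let N f := negative_power P beta f.

Let NE f p : Linfty mu f -> N f p = c * potential mu K beta (t f) p.
Proof.
move=> fL; congr (_ * _); apply: eq_Rintegral => s; rewrite inE/= in_itv/= andbT => s0.
by rewrite PQ// tQ// -powRN opprB.
Qed.

Let N_bounded : exists2 C : R, 0 <= C & forall f, Linfty mu f -> bounded_by (C * M f) (N f).
Proof.
have [C C0 CP] := potential_bounded pkK beta_gt0.
exists (`|c| * C); first exact: mulr_ge0.
move=> f fL; have [mp pM] := CP _ _ (tM fL).
rewrite (_ : N f = fun p => c * potential mu K beta (t f) p); last first.
  by apply/funext => p; exact: NE.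
split; first exact: measurable_funM.
by move=> q; rewrite normrM -mulrA ler_wpM2l.
Qed.

Let N_Linfty f : Linfty mu f -> Linfty mu (N f).
Proof.
move=> fL; have [C C0 CP] := N_bounded.
by apply: bounded_Linfty (CP _ fL) _; rewrite mulr_ge0.
Qed.

Let derive_N f l y p : Linfty mu f -> 0 < y ->
  derive1n l (fun s : R => P s (N f) p) y = c * Q l y (potential mu K beta (t f)) p.
Proof.
move=> fL y0; rewrite (derive_P l p (N_Linfty fL) y0) -(tQ l p (N_Linfty fL) y0).
have [C C0 CP] := potential_bounded pkK beta_gt0.
have ip := kernel_op_integrable pkK (CP _ _ (tM fL)) l p y0.
transitivity (\int[mu]_q (c * (K l y p q * potential mu K beta (t f) q))).
  apply: eq_Rintegral => q _.
by rewrite NE// mulrCA.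
exact: (RintegralZl c measurableT ip).
Qed.

(** Pointwise decay of the derivatives of P_y f becomes a Zygmund bound for the
    negative power of f. *)
Let bound_of_decay m : 2 * beta < m -> exists2 C : R, 0 <= C & forall l f (A : R),
  Linfty mu f -> 0 <= A ->
  (forall s p, 0 < s -> `|Q l s (t f) p| <= A * s `^ (- m)) ->
  forall y, 0 < y ->
  (Linfty_norm mu (fun p => derive1n l (fun s : R => P s (N f) p) y) <=
    (C * A * y `^ (2 * beta - m))%:E)%E.
Proof.
move=> bm; have [C C0 CP] := kernel_op_potential_le pkK beta_gt0 bm.
exists (`|c| * C); first exact: mulr_ge0.
move=> l f A fL A0 QA y y0; apply: Linfty_norm_le.
  by rewrite !mulr_ge0 ?powR_ge0.
move=> p; rewrite derive_N// normrM -!mulrA ler_wpM2l// mulrA.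
by apply: (CP _ _ _ _ _ (tM fL)) => // s; exact: QA.
Qed.

(** Splitting y in two halves turns the Zygmund bound on the derivative of order
    k = [alpha] + 1 into one on the derivative of order l >= k. *)
Let regularity_bound alpha : 0 < alpha -> exists2 C : R, 0 <= C & forall f A,
  Linfty mu f -> zygmund_bounds mu P alpha f A ->
  zygmund_bounds mu P (alpha + 2 * beta) (N f) (C * A).
Proof.
move=> alpha0; pose k := (Num.truncn alpha).+1; pose l := (Num.truncn (alpha + 2 * beta)).+1.
have kl : (k <= l)%N.
  by rewrite ltnS le_truncn// lerDl mulr_ge0// ltW.
have bm : 2 * beta < l%:R - alpha.
  by rewrite ltrBrDl truncnS_gt.
have [C2 C20 CP2] := bound_of_decay bm.
have [C1 C10 CP1] := kernel_op_le_ae pkK (k := (l - k)%N) (lexx (l - k)%:R).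
exists (C2 * (C1 * 2 `^ (l%:R - alpha))); first by rewrite !mulr_ge0 ?powR_ge0.
move=> f A fL fA y y0.
have A0 := zygmund_bounds_ge0 fA.
have -> : - l%:R + (alpha + 2 * beta) = 2 * beta - (l%:R - alpha) by ring.
rewrite -(mulrA C2); apply: CP2 => //; first by rewrite !mulr_ge0 ?powR_ge0.
move=> s p s0; have s20 : 0 < s / 2 by rewrite divr_gt0.
have -> : Q l s (t f) p = Q (l - k) (s / 2) (Q k (s / 2) (t f)) p.
  rewrite (kernel_op_semigroup pkK _ _ _ (tM fL))// subnK//.
  by congr (Q _ _ _ _); field.
have [M' gM'] := kernel_op_bounded pkK k (tM fL) s20.
have Ap : 0 <= A * (s / 2) `^ (- k%:R + alpha) by rewrite mulr_ge0 ?powR_ge0.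
have ae : {ae mu, forall q, `|Q k (s / 2) (t f) q| <= A * (s / 2) `^ (- k%:R + alpha)}.
  have := Linfty_norm_ae mu (fun q => derive1n k (fun s : R => P s f q) (s / 2)).
  apply: filterS => q; rewrite derive_P// => h.
  by rewrite -lee_fin (le_trans h)//; exact: fA.
apply: (le_trans (CP1 _ _ _ gM' Ap ae _ p s20)).
have E : (s / 2) `^ (- k%:R + alpha) * (s / 2) `^ (- (l - k)%:R) =
    2 `^ (l%:R - alpha) * s `^ (- (l%:R - alpha)).
  rewrite -powRD_gt0// natrB// (_ : _ + _ = - (l%:R - alpha)); last by ring.
  rewrite mulrC powRM ?invr_ge0 ?(ltW s0)// -powR_inv1// -powRrM; congr (_ `^ _ * _).
  by ring.
rewrite [leRHS](_ : _ = C1 * A * (2 `^ (l%:R - alpha) * s `^ (- (l%:R - alpha)))); last by ring.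
by rewrite -E !mulrA.
Qed.

(** The infimum over admissible constants need not be attained, so the bound for
    each of them is passed to the infimum; the constant C + 1 instead of C
    keeps the factor positive there. *)
Theorem regularity_of_negative_power alpha : 0 < alpha ->
  exists2 C : R, 0 <= C & forall f, Lambda mu P alpha f ->
    Lambda mu P (alpha + 2 * beta) (negative_power P beta f) /\
    (Lambda_norm mu P (alpha + 2 * beta) (negative_power P beta f)
       <= C%:E * Lambda_norm mu P alpha f)%E.
Proof.
move=> alpha0; have [C C0 CP] := regularity_bound alpha0.
have [C' C'0 CP'] := N_bounded.
exists (C' + (C + 1)); first by rewrite !addr_ge0.
move=> f [fL [A fA]]; split.
  by split; [exact: N_Linfty|exists (C * A); exact: CP].
rewrite /Lambda_norm.
rewrite ge0_muleDr ?Linfty_norm_ge0 ?ereal_inf_zygmund_bounds_ge0//; apply: leeD.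
  have [_ NM] := CP' _ fL.
  apply: (le_trans (Linfty_norm_le mu (mulr_ge0 C'0 (M_ge0 f)) NM)).
  by rewrite (ME fL) -EFinM lee_fin ler_wpM2r// lerDl addr_ge0.
apply: (@le_trans _ _ ((C + 1)%:E * ereal_inf [set x%:E | x in zygmund_bounds mu P alpha f])%E).
  apply: ereal_inf_scale; first by rewrite ltr_wpDl.
  move=> x fx y y0; apply: (le_trans (CP _ _ fL fx y y0)).
  by rewrite lee_fin ler_wpM2r ?powR_ge0// ler_wpM2r ?(zygmund_bounds_ge0 fx)// lerDl.
by rewrite lee_wpmul2r ?ereal_inf_zygmund_bounds_ge0// lee_fin lerDr.
Qed.

(** The kernel bound of order l + beta, with l = [beta] + 1, exceeds both l and
    2 beta; the first makes it available and the second makes it integrable. *)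
Theorem negative_power_Linfty :
  exists2 C : R, 0 <= C & forall f, Linfty mu f ->
    Lambda mu P beta (negative_power P beta f) /\
    (Lambda_norm mu P beta (negative_power P beta f) <= C%:E * Linfty_norm mu f)%E.
Proof.
pose l := (Num.truncn beta).+1.
have lb : beta < l%:R by rewrite truncnS_gt.
have bm : 2 * beta < l%:R + beta by lra.
have lm : l%:R <= l%:R + beta by rewrite lerDl ltW.
have [C2 C20 CP2] := bound_of_decay bm.
have [C1 C10 CP1] := kernel_op_le pkK lm.
have [C' C'0 CP'] := N_bounded.
exists (C' + C2 * C1); first by rewrite !addr_ge0 ?mulr_ge0.
move=> f fL.
have NA : zygmund_bounds mu P beta (N f) (C2 * (C1 * M f)).
  move=> y y0; have -> : - (Num.truncn beta).+1%:R + beta = 2 * beta - (l%:R + beta).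
    by rewrite /l; ring.
  apply: CP2 => //; first by rewrite mulr_ge0.
  by move=> s p s0; exact: CP1 (tM fL) _ _ s0.
split.
  by split; [exact: N_Linfty|eexists; exact: NA].
rewrite (ME fL) -EFinM mulrDl -mulrA EFinD; apply: leeD.
  by have [_ NM] := CP' _ fL; apply: Linfty_norm_le => //; rewrite mulr_ge0.
by apply: ereal_inf_lbound; exists (C2 * (C1 * M f)).
Qed.

End zygmund_potential.

(** * Reflections of the line *)

Section reflection.
Context {R : realType}.
Notation leb := (@lebesgue_measure R).

Lemma lebesgue_measure_reflection (t : R) (A : set R) :
  measurable A -> leb ((fun s => t - s) @^-1` A) = leb A.
Proof.
have mr : measurable_fun setT (fun s : measurableTypeR R => t - s : measurableTypeR R).
  exact: measurable_funB.
pose M : {measure set (measurableTypeR R) -> \bar R} :=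
  pushforward leb (fun s : measurableTypeR R => t - s : measurableTypeR R).
move=> mA; apply/esym; apply: (lebesgue_measure_unique (mu := M mr)) => // _ [[a b] _ <-].
rewrite /M /= /pushforward.
rewrite (_ : _ @^-1` _ = `[t - b, t - a[%classic); last first.
  apply/seteqP; split => s /=; rewrite !in_itv/= => /andP[h1 h2]; apply/andP; split; lra.
rewrite !lebesgue_measure_itv/= !lte_fin ltrD2l ltrN2.
by case: ifPn => // _; rewrite -!EFinD; congr EFin; ring.
Qed.

Lemma ge0_integral_reflection (t : R) (f : R -> \bar R) :
  measurable_fun setT f -> (forall s, (0 <= f s)%E) ->
  (\int[leb]_s f (t - s)%R = \int[leb]_s f s)%E.
Proof.
move=> mf f0.
have mr : measurable_fun setT (fun s : measurableTypeR R => t - s : measurableTypeR R).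
  exact: measurable_funB.
have := ge0_integral_pushforward mr leb (D := setT) measurableT mf (fun s _ => f0 s).
rewrite preimage_setT => <-; apply: eq_measure_integral => A mA _.
exact: lebesgue_measure_reflection.
Qed.

Lemma integral_reflection (t : R) (f : R -> \bar R) :
  leb.-integrable setT f -> (\int[leb]_s f (t - s)%R = \int[leb]_s f s)%E.
Proof.
move=> /integrableP[mf fi].
rewrite [LHS]integralE [RHS]integralE; congr (_ - _)%E.
  rewrite -(ge0_integral_reflection t (measurable_funepos mf)) => [|s]; last exact: funepos_ge0.
  by apply: eq_integral => s _; rewrite !funeposE.
rewrite -(ge0_integral_reflection t (measurable_funeneg mf)) => [|s]; last exact: funeneg_ge0.
by apply: eq_integral => s _; rewrite !funenegE.
Qed.

End reflection.

(** * Mehler's kernel *)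

Section hyperbolic_facts.
Context {R : realType}.
Implicit Types x t a b : R.

Lemma cosh_gt0 x : 0 < cosh x.
Proof. by rewrite /cosh divr_gt0// addr_gt0// expR_gt0. Qed.

Lemma sinh_gt0 x : 0 < x -> 0 < sinh x.
Proof.
by move=> x0; rewrite /sinh divr_gt0// subr_gt0 ltr_expR; lra.
Qed.

Lemma coshD x t : cosh (x + t) = cosh x * cosh t + sinh x * sinh t.
Proof. by rewrite /cosh /sinh opprD !expRD; field. Qed.

Lemma sinhD x t : sinh (x + t) = sinh x * cosh t + cosh x * sinh t.
Proof. by rewrite /cosh /sinh opprD !expRD; field. Qed.

Lemma cosh_sqr x : cosh x ^+ 2 = 1 + sinh x ^+ 2.
Proof.
have := expRxMexpNx_1 x; rewrite /cosh /sinh.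
set e := expR x; set e' := expR (- x) => ee'.
by transitivity (e * e' + ((e - e') / 2) ^+ 2); [field|rewrite ee'].
Qed.

Lemma cothE t : 0 < t -> coth t = (cosh (2 * t) + 1) / sinh (2 * t).
Proof.
move=> t0; have st := sinh_gt0 t0; have ct := cosh_gt0 t.
rewrite mulr_natl mulr2n coshD sinhD /coth -!expr2 cosh_sqr.
rewrite [in RHS](_ : 1 + sinh t ^+ 2 + sinh t ^+ 2 + 1 = 2 * cosh t ^+ 2); last by rewrite cosh_sqr; ring.
rewrite (_ : sinh t * cosh t + _ = 2 * sinh t * cosh t); last by ring.
by field; rewrite !gt_eqF.
Qed.

Lemma tanhE t : 0 < t -> tanh t = (cosh (2 * t) - 1) / sinh (2 * t).
Proof.
move=> t0; have st := sinh_gt0 t0; have ct := cosh_gt0 t.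
rewrite mulr_natl mulr2n coshD sinhD /tanh -!expr2 cosh_sqr.
rewrite (_ : sinh t * cosh t + _ = 2 * sinh t * cosh t); last by ring.
by field; rewrite !gt_eqF.
Qed.

Lemma cosh_ge1 x : 1 <= cosh x.
Proof.
have h : 1 <= cosh x ^+ 2 by rewrite cosh_sqr lerDl sqr_ge0.
by rewrite -(@expr_ge1 _ 2)// ltW// cosh_gt0.
Qed.

Lemma cosh_ge_exp x : expR x / 2 <= cosh x.
Proof. by rewrite /cosh ler_pM2r ?invr_gt0// lerDl expR_ge0. Qed.

End hyperbolic_facts.

Section mehler_line.
Context {R : realType}.
Notation leb := (@lebesgue_measure R).
Implicit Types t a b z : R.

(** Completing the square reduces this to the total mass of a normal density. *)
Lemma gaussian_integral (A B : R) : 0 < A ->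
  (\int[leb]_z (expR (- (A * z ^+ 2 / 2 - B * z)))%:E =
   (Num.sqrt (2 * pi / A) * expR (B ^+ 2 / (2 * A)))%:E)%E.
Proof.
move=> A0; pose s := Num.sqrt A^-1; pose m := B / A.
have s2 : s ^+ 2 = A^-1 by rewrite sqr_sqrtr// invr_ge0 ltW.
have s0 : s != 0 by rewrite gt_eqF// sqrtr_gt0 invr_gt0.
have pk : Num.sqrt (2 * pi / A) * normal_peak s = 1.
  rewrite /normal_peak s2 (_ : A^-1 * pi *+ 2 = 2 * pi / A); last by rewrite -mulr_natr; ring.
  by rewrite mulfV// gt_eqF// sqrtr_gt0 divr_gt0// mulr_gt0// pi_gt0.
have E z : expR (- (A * z ^+ 2 / 2 - B * z)) =
    Num.sqrt (2 * pi / A) * expR (B ^+ 2 / (2 * A)) * normal_pdf m s z.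
  rewrite normal_pdfE// /normal_fun s2 mulrACA pk mul1r -expRD; congr expR.
  by rewrite /m -mulr_natr; field; rewrite gt_eqF.
under eq_integral do rewrite E EFinM.
rewrite integralZl//; last exact: integrable_normal_pdf.
by rewrite integral_normal_pdf mule1.
Qed.

(** The factor of Mehler's kernel for one coordinate, with coth t and tanh t written
    in terms of the double angle.  Inverses are powers with exponent -1, for the
    sake of joint measurability in t and the points. *)
Definition mehler_line t a b : R :=
  (2 * pi * sinh (2 * t)) `^ (- 2^-1) *
  expR (- ((cosh (2 * t) * (a ^+ 2 + b ^+ 2) - 2 * a * b) * (2 * sinh (2 * t)) `^ (- 1))).

Lemma mehler_line_ge0 t a b : 0 <= mehler_line t a b.
Proof. by rewrite mulr_ge0 ?powR_ge0 ?expR_ge0. Qed.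

Lemma mehler_lineE t a b : 0 < t -> mehler_line t a b =
  (Num.sqrt (2 * pi * sinh (2 * t)))^-1 *
  expR (- ((cosh (2 * t) * (a ^+ 2 + b ^+ 2) - 2 * a * b) / (2 * sinh (2 * t)))).
Proof.
move=> t0; have S0 : 0 < sinh (2 * t) by rewrite sinh_gt0// mulr_gt0.
have h1 : 0 <= 2 * pi * sinh (2 * t).
  by apply: mulr_ge0; [rewrite mulr_ge0// pi_ge0|exact: ltW].
have h2 : 0 <= 2 * sinh (2 * t) by apply: mulr_ge0 => //; exact: ltW.
by rewrite /mehler_line powRN powR12_sqrt// powR_inv1.
Qed.

Lemma measurable_mehler_line :
  measurable_fun setT (fun v : R * (R * R) => mehler_line v.1 v.2.1 v.2.2).
Proof.
have m1 : measurable_fun setT (fun v : R * (R * R) => v.1) by exact: measurable_fst.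
have m2 : measurable_fun setT (fun v : R * (R * R) => v.2.1).
  exact: (measurableT_comp measurable_fst measurable_snd).
have m3 : measurable_fun setT (fun v : R * (R * R) => v.2.2).
  exact: (measurableT_comp measurable_snd measurable_snd).
have me : measurable_fun setT (fun v : R * (R * R) => expR (2 * v.1)).
  by apply: measurableT_comp => //; exact: measurable_funM.
have me' : measurable_fun setT (fun v : R * (R * R) => expR (- (2 * v.1))).
  by apply: measurableT_comp => //; apply: measurableT_comp => //; exact: measurable_funM.
have mS : measurable_fun setT (fun v : R * (R * R) => sinh (2 * v.1)).
  by apply: measurable_funM => //; exact: measurable_funB.
have mC : measurable_fun setT (fun v : R * (R * R) => cosh (2 * v.1)).
  by apply: measurable_funM => //; exact: measurable_funD.
apply: measurable_funM.
  by apply: (measurableT_comp (measurable_powR _)); exact: measurable_funM.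
apply: measurableT_comp => //; apply: measurableT_comp => //.
apply: measurable_funM; last first.
  by apply: (measurableT_comp (measurable_powR _)); exact: measurable_funM.
apply: measurable_funB; last by apply: measurable_funM => //; exact: measurable_funM.
by apply: measurable_funM => //; apply: measurable_funD; exact: measurable_funX.
Qed.

(** The exponent is quadratic in z, so this is a Gaussian integral; the addition
    formulas of the hyperbolic functions identify the result. *)
Lemma mehler_line_semigroup t u a b : 0 < t -> 0 < u ->
  (\int[leb]_z (mehler_line t a z * mehler_line u z b)%:E = (mehler_line (t + u) a b)%:E)%E.
Proof.
move=> t0 u0.
have S1 : 0 < sinh (2 * t) by rewrite sinh_gt0// mulr_gt0.
have S2 : 0 < sinh (2 * u) by rewrite sinh_gt0// mulr_gt0.
have S3 : 0 < sinh (2 * (t + u)) by rewrite sinh_gt0// mulr_gt0// addr_gt0.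
have E3 : sinh (2 * (t + u)) = sinh (2 * t) * cosh (2 * u) + cosh (2 * t) * sinh (2 * u).
  by rewrite mulrDr sinhD.
have F3 : cosh (2 * (t + u)) = cosh (2 * t) * cosh (2 * u) + sinh (2 * t) * sinh (2 * u).
  by rewrite mulrDr coshD.
have Q1 := cosh_sqr (2 * t); have Q2 := cosh_sqr (2 * u).
under eq_integral do rewrite !mehler_lineE//.
rewrite mehler_lineE ?addr_gt0//.
move: (sinh (2 * t)) (sinh (2 * u)) (sinh (2 * (t + u))) (cosh (2 * t)) (cosh (2 * u)) (cosh (2 * (t + u)))
  S1 S2 S3 E3 F3 Q1 Q2 => s1 s2 s3 c1 c2 c3 S1 S2 S3 E3 F3 Q1 Q2.
pose A := s3 / (s1 * s2); pose B := a / s1 + b / s2.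
have A0 : 0 < A by rewrite divr_gt0// mulr_gt0.
pose k := (Num.sqrt (2 * pi * s1))^-1 * (Num.sqrt (2 * pi * s2))^-1 *
  expR (- (c1 * a ^+ 2 / (2 * s1) + c2 * b ^+ 2 / (2 * s2))).
have E z : (Num.sqrt (2 * pi * s1))^-1 * expR (- ((c1 * (a ^+ 2 + z ^+ 2) - 2 * a * z) / (2 * s1))) *
   ((Num.sqrt (2 * pi * s2))^-1 * expR (- ((c2 * (z ^+ 2 + b ^+ 2) - 2 * z * b) / (2 * s2)))) =
   k * expR (- (A * z ^+ 2 / 2 - B * z)).
  rewrite /k; set n1 := (Num.sqrt _)^-1; set n2 := (Num.sqrt _)^-1.
  set e1 := expR _; set e2 := expR _; set e3 := expR _; set e4 := expR _.
  have Ee : e1 * e2 = e3 * e4.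
    rewrite /e1 /e2 /e3 /e4 -!expRD; congr expR.
    by rewrite /A /B E3; field; rewrite !gt_eqF.
  by transitivity (n1 * n2 * (e1 * e2)); [ring|rewrite Ee; ring].
under eq_integral do rewrite E EFinM.
rewrite ge0_integralZl//; last 2 first.
- apply/measurable_EFinP; apply: measurableT_comp => //; apply: measurableT_comp => //.
  apply: measurable_funB; last exact: measurable_funM.
  by apply: measurable_funM => //; apply: measurable_funM => //; exact: measurable_funX.
- by rewrite lee_fin !mulr_ge0 ?invr_ge0 ?sqrtr_ge0 ?expR_ge0.
rewrite gaussian_integral// -EFinM; congr EFin.
rewrite /k mulrACA -expRD; congr (_ * expR _).
  rewrite -!sqrtrV ?mulr_ge0 ?pi_ge0 ?ltW// -!sqrtrM ?invr_ge0 ?mulr_ge0 ?invr_ge0 ?mulr_ge0 ?pi_ge0 ?ltW//.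
  congr Num.sqrt; rewrite /A; move: (pi : R) (pi_gt0 R) => p p0.
  by field; rewrite !gt_eqF.
have h1 : c1 * s3 - s2 = s1 * c3 by rewrite E3 F3 mulrDr [c1 * (c1 * s2)]mulrA -expr2 Q1; ring.
have h2 : c2 * s3 - s1 = s2 * c3 by rewrite E3 F3 mulrDr mulrCA -expr2 Q2; ring.
have e1 : c1 = (s1 * c3 + s2) / s3 by rewrite -h1; field; rewrite gt_eqF.
have e2 : c2 = (s2 * c3 + s1) / s3 by rewrite -h2; field; rewrite gt_eqF.
rewrite /B /A {E} e1 e2; clear -S1 S2 S3.
by field; rewrite !gt_eqF.
Qed.

(** The mass is (cosh 2t)^(-1/2) e^(-a^2 tanh(2t) / 2), and cosh 2t >= e^(2t) / 2:
    the rate 1 of decay is the lowest eigenvalue of the oscillator. *)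
Lemma mehler_line_mass t a : 0 < t ->
  exists2 m : R, (\int[leb]_z (mehler_line t a z)%:E = m%:E)%E &
    0 <= m /\ m <= 1 /\ m <= Num.sqrt 2 * expR (- t).
Proof.
move=> t0.
have S1 : 0 < sinh (2 * t) by rewrite sinh_gt0// mulr_gt0.
have C1 := cosh_gt0 (2 * t).
have Q := cosh_sqr (2 * t).
have Cge1 := cosh_ge1 (2 * t).
have Cexp : expR t ^+ 2 / 2 <= cosh (2 * t).
  by have := cosh_ge_exp (2 * t); rewrite expRM_natl.
under eq_integral do rewrite mehler_lineE//.
move: (sinh (2 * t)) (cosh (2 * t)) S1 C1 Q Cge1 Cexp => s c S1 C1 Q Cge1 Cexp.
pose A := c / s; pose B := a / s.
have A0 : 0 < A by rewrite divr_gt0.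
pose k := (Num.sqrt (2 * pi * s))^-1 * expR (- (c * a ^+ 2 / (2 * s))).
have E z : (Num.sqrt (2 * pi * s))^-1 * expR (- ((c * (a ^+ 2 + z ^+ 2) - 2 * a * z) / (2 * s))) =
   k * expR (- (A * z ^+ 2 / 2 - B * z)).
  rewrite /k; set n1 := (Num.sqrt _)^-1.
  set e1 := expR _; set e3 := expR _; set e4 := expR _.
  have -> : e1 = e3 * e4; last by ring.
  rewrite /e1 /e3 /e4 -!expRD; congr expR.
  by rewrite /A /B; field; rewrite gt_eqF.
exists ((Num.sqrt c)^-1 * expR (- (a ^+ 2 * s / (2 * c)))).
  under eq_integral do rewrite E EFinM.
  rewrite ge0_integralZl//; last 2 first.
  - apply/measurable_EFinP; apply: measurableT_comp => //; apply: measurableT_comp => //.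
    apply: measurable_funB; last exact: measurable_funM.
    by apply: measurable_funM => //; apply: measurable_funM => //; exact: measurable_funX.
    - by rewrite lee_fin !mulr_ge0 ?invr_ge0 ?sqrtr_ge0 ?expR_ge0.
  rewrite gaussian_integral// -EFinM; congr EFin.
  rewrite /k mulrACA -expRD; congr (_ * expR _).
    rewrite -!sqrtrV ?mulr_ge0 ?pi_ge0 ?ltW// -!sqrtrM ?invr_ge0 ?mulr_ge0 ?invr_ge0 ?mulr_ge0 ?pi_ge0 ?ltW//.
    congr Num.sqrt; rewrite /A; move: (pi : R) (pi_gt0 R) => p p0.
    by field; rewrite !gt_eqF.
  rewrite /A /B.
  have -> : a ^+ 2 * s / (2 * c) = a ^+ 2 * s ^+ 2 / (2 * c * s) by field; rewrite !gt_eqF.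
  have -> : s ^+ 2 = c ^+ 2 - 1 by rewrite Q; ring.
  by field; rewrite !gt_eqF.
have e1 : expR (- (a ^+ 2 * s / (2 * c))) <= 1.
  rewrite expR_le1 oppr_le0; apply: divr_ge0; first exact: mulr_ge0 (sqr_ge0 a) (ltW S1).
  by apply: mulr_ge0 => //; exact: ltW.
have c0 : 0 <= (Num.sqrt c)^-1 by rewrite invr_ge0 sqrtr_ge0.
split; first by rewrite mulr_ge0 ?expR_ge0.
have le : (Num.sqrt c)^-1 * expR (- (a ^+ 2 * s / (2 * c))) <= (Num.sqrt c)^-1 by rewrite ler_piMr.
split; apply: (le_trans le).
  by rewrite invf_le1 ?sqrtr_gt0// -sqrtr1 ler_sqrt// ltW.
rewrite expRN -[leRHS]invrK lef_pV2 ?posrE ?sqrtr_gt0 ?invr_gt0 ?divr_gt0 ?sqrtr_gt0 ?expR_gt0//.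
rewrite invf_div -[leLHS]ger0_norm ?divr_ge0 ?expR_ge0 ?sqrtr_ge0// -sqrtr_sqr.
by rewrite ler_sqrt// ?(ltW C1)// expr_div_n sqr_sqrtr.
Qed.

End mehler_line.

Section product_integral.
Context {R : realType}.
Notation leb := (@lebesgue_measure R).

Lemma integral_lebesgue_tuple_prod n (f : 'I_n -> R -> R) (m : 'I_n -> R) :
  (forall i, measurable_fun setT (f i)) -> (forall i u, 0 <= f i u) ->
  (forall i, (\int[leb]_u (f i u)%:E = (m i)%:E)%E) ->
  (\int[lebesgue_tuple n]_z (\prod_(i < n) f i (tnth z i))%:E = (\prod_(i < n) m i)%:E)%E.
Proof.
elim: n f m => [|n IH] f m mf f0 fm.
  under eq_integral do rewrite big_ord0.
  by rewrite integral_dirac// diracT mul1e big_ord0.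
have mT : measurable_fun setT (fun z : n.+1.-tuple R => (\prod_(i < n.+1) f i (tnth z i))%:E).
  apply/measurable_EFinP; apply: measurable_prod => i _.
  exact: (measurableT_comp (mf i) (measurable_tnth i)).
have := ge0_integral_pushforward (@measurable_pcons R n) (leb \x lebesgue_tuple n)%E (D := setT) measurableT mT.
rewrite preimage_setT => h.
transitivity (\int[leb \x lebesgue_tuple n]_v (\prod_(i < n.+1) f i (tnth (pcons v) i))%:E)%E.
  rewrite -h; last by move=> z _; rewrite lee_fin prodr_ge0.
  by apply: eq_measure_integral => [|mp A mA _]; first exact: measurable_pcons.
have mp : measurable_fun setT (fun v : measurableTypeR R * n.-tuple R =>
    (\prod_(i < n.+1) f i (tnth (pcons v) i))%:E).
  exact: (measurableT_comp mT (@measurable_pcons R n)).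
rewrite fubini_tonelli1//; last by move=> v; rewrite lee_fin prodr_ge0.
rewrite /fubini_F.
have E u : (\int[lebesgue_tuple n]_z (\prod_(i < n.+1) f i (tnth (pcons (u, z)) i))%:E =
    (\prod_(i < n) m (lift ord0 i))%:E * (f ord0 u)%:E)%E.
  under eq_integral => z _.
    rewrite big_ord_recl (_ : tnth _ ord0 = u)// EFinM.
    under eq_bigr do rewrite tnthS.
    over.
  rewrite ge0_integralZl//; last 3 first.
  - apply/measurable_EFinP; apply: measurable_prod => i _.
    exact: (measurableT_comp (mf _) (measurable_tnth i)).
  - by move=> z _; rewrite lee_fin prodr_ge0.
  - by rewrite lee_fin.
  by rewrite (IH (fun i => f (lift ord0 i)) (fun i => m (lift ord0 i)))// muleC.
under eq_integral do rewrite E.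
rewrite ge0_integralZl//; last 3 first.
- by apply/measurable_EFinP; exact: mf.
- by move=> u _; rewrite lee_fin.
- rewrite lee_fin prodr_ge0// => i _; rewrite -lee_fin -fm.
  by apply: integral_ge0 => u _; rewrite lee_fin.
by rewrite fm -EFinM big_ord_recl mulrC.
Qed.

End product_integral.

Section mehler_space.
Context {R : realType} {n : nat}.
Implicit Types (t u : R) (x z w : n.-tuple R).

Definition mehler_prod t x z : R := \prod_(i < n) mehler_line t (tnth x i) (tnth z i).

Lemma mehler_prod_ge0 t x z : 0 <= mehler_prod t x z.
Proof. by apply: prodr_ge0 => i _; exact: mehler_line_ge0. Qed.

Lemma mehlerE t x z : 0 < t -> mehler t x z = mehler_prod t x z.
Proof.
move=> t0; have S0 : 0 < sinh (2 * t) by rewrite sinh_gt0// mulr_gt0.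
have h1 : 0 <= 2 * pi * sinh (2 * t).
  by apply: mulr_ge0; [rewrite mulr_ge0// pi_ge0|exact: ltW].
rewrite /mehler_prod; under eq_bigr do rewrite mehler_lineE//.
rewrite big_split/= prodr_const card_ord -expR_sum /mehler -expRD mulrC; congr (_ * expR _).
  by rewrite (mulrC n%:R) powRrM powR12_sqrt// powR_mulrn ?sqrtr_ge0// exprVn.
rewrite cothE// tanhE// /sqdist /sqsum -opprD sumrN; congr (- _).
rewrite -!mulrA !mulr_suml -big_split/=; apply: eq_bigr => i _.
move: (sinh (2 * t)) (cosh (2 * t)) S0 => s c S0.
by field; rewrite gt_eqF.
Qed.

Lemma measurable_mehler_prod :
  measurable_fun setT (fun v : R * (n.-tuple R * n.-tuple R) => mehler_prod v.1 v.2.1 v.2.2).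
Proof.
apply: measurable_prod => i _.
apply: (measurableT_comp measurable_mehler_line
  (g := fun v : R * (n.-tuple R * n.-tuple R) => (v.1, (tnth v.2.1 i, tnth v.2.2 i)))).
apply/measurable_fun_pairP; split; first exact: measurable_fst.
apply/measurable_fun_pairP; split.
  exact: (measurableT_comp (measurable_tnth i) (measurableT_comp measurable_fst measurable_snd)).
exact: (measurableT_comp (measurable_tnth i) (measurableT_comp measurable_snd measurable_snd)).
Qed.

Lemma measurable_mehler_line1 t a : measurable_fun setT (mehler_line t a : R -> R).
Proof.
apply: (measurableT_comp measurable_mehler_line (g := fun z : R => (t, (a, z)))).
by apply: measurable_fun_pair => //; exact: measurable_fun_pair.
Qed.

Lemma measurable_mehler_line2 t a : measurable_fun setT (fun v : R => mehler_line t v a).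
Proof.
apply: (measurableT_comp measurable_mehler_line (g := fun z : R => (t, (z, a)))).
by apply: measurable_fun_pair => //; exact: measurable_fun_pair.
Qed.

Lemma mehler_prod_semigroup t u x w : 0 < t -> 0 < u ->
  (\int[lebesgue_tuple n]_z (mehler_prod t x z * mehler_prod u z w)%:E =
   (mehler_prod (t + u) x w)%:E)%E.
Proof.
move=> t0 u0; rewrite /mehler_prod; under eq_integral do rewrite -big_split/=.
apply: (@integral_lebesgue_tuple_prod R n
  (fun i v => mehler_line t (tnth x i) v * mehler_line u v (tnth w i))
  (fun i => mehler_line (t + u) (tnth x i) (tnth w i))).
- move=> i; apply: measurable_funM; [exact: measurable_mehler_line1|exact: measurable_mehler_line2].
- by move=> i z; rewrite mulr_ge0 ?mehler_line_ge0.
- by move=> i; exact: mehler_line_semigroup.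
Qed.

(** One coordinate provides the exponential decay, the others contribute factors
    at most 1. *)
Lemma mehler_prod_mass t x : (1 <= n)%N -> 0 < t ->
  exists2 m : R, (\int[lebesgue_tuple n]_z (mehler_prod t x z)%:E = m%:E)%E &
    0 <= m /\ m <= 1 /\ m <= Num.sqrt 2 * expR (- t).
Proof.
move=> n1 t0.
have [m mE mP] : exists2 m : 'I_n -> R,
    forall i, (\int[lebesgue_measure]_z (mehler_line t (tnth x i) z)%:E = (m i)%:E)%E &
    forall i, 0 <= m i /\ m i <= 1 /\ m i <= Num.sqrt 2 * expR (- t).
  exists (fun i => sval (cid2 (mehler_line_mass (tnth x i) t0))) => i.
    by case: cid2.
  by case: cid2.
exists (\prod_(i < n) m i).
  apply: (@integral_lebesgue_tuple_prod R n (fun i => mehler_line t (tnth x i)) m) => //.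
  - by move=> i; exact: measurable_mehler_line1.
  - by move=> i z; exact: mehler_line_ge0.
have m0 i : 0 <= m i by have [] := mP i.
have m1 i : m i <= 1 by have [_ []] := mP i.
split; first exact: prodr_ge0.
split; first by apply: prodr_ile1 => i _; rewrite m0 m1.
case: n n1 x m mE mP m0 m1 => // k _ x m mE mP m0 m1.
rewrite big_ord_recl; have [_ [_ h]] := mP ord0; rewrite -[leRHS]mulr1.
apply: ler_pM => //; first exact: prodr_ge0.
by apply: prodr_ile1 => i _; rewrite m0 m1.
Qed.

End mehler_space.

(** * The Poisson kernel on space-time *)

Section product_sigma_finite.
Context d1 d2 (X : measurableType d1) (Y : measurableType d2) (R : realType)
  (m1 : {sigma_finite_measure set X -> \bar R}) (m2 : {sigma_finite_measure set Y -> \bar R}).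

(** The product measure, under a name that carries its sigma-finiteness. *)
Definition product_sf_measure : set (X * Y) -> \bar R := (m1 \x m2)%E.

HB.instance Definition _ := Measure.on product_sf_measure.

Let product_sf_measure_sigma_finite : sigma_finite setT product_sf_measure.
Proof.
have /sigma_finiteP[F [TF ndF Foo]] := sigma_finiteT m1.
have /sigma_finiteP[G [TG ndG Goo]] := sigma_finiteT m2.
exists (fun k => F k `*` G k).
  apply/seteqP; split => // -[x y] _.
  have [i _ Fi] : (\bigcup_k F k) x by rewrite -TF.
  have [j _ Gj] : (\bigcup_k G k) y by rewrite -TG.
  exists (maxn i j) => //; split.
    by move: Fi; exact/subsetPset/ndF/leq_maxl.
  by move: Gj; exact/subsetPset/ndG/leq_maxr.
move=> k; have [mF Fk] := Foo k; have [mG Gk] := Goo k.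
split; first exact: measurableX.
by rewrite /product_sf_measure product_measure1E// lte_mul_pinfty// ge0_fin_numE.
Qed.

HB.instance Definition _ := Measure_isSigmaFinite.Build _ _ _ product_sf_measure
  product_sf_measure_sigma_finite.

End product_sigma_finite.

Section spacetime_kernel.
Context {R : realType} {n : nat}.
Notation leb := (@lebesgue_measure R).
Notation T := (spacetime R n).
Notation mu := (leb \x lebesgue_tuple n)%E.
Notation D := (`]0%R, +oo[%classic : set R).
Implicit Types (w : R -> R) (p q r : T) (y s t : R).

Let D0 s : (s \in D) = (0 < s).
Proof. by apply/idP/idP; rewrite inE/= in_itv/= andbT. Qed.

(** The kernel of the operator \int_0^oo w(s) e^(-s L) ds: heat flows forward in
    time, so the elapsed time p.1 - q.1 determines s and has to be positive. *)
Definition heat_kernel w p q : R :=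
  \1_D (p.1 - q.1) * (w (p.1 - q.1) * mehler_prod (p.1 - q.1) p.2 q.2).

Lemma heat_kernel_ge0 w p q : (forall s, 0 < s -> 0 <= w s) -> 0 <= heat_kernel w p q.
Proof.
move=> w0; rewrite /heat_kernel indicE D0; case: ltP => h; last by rewrite mul0r.
by rewrite mul1r mulr_ge0 ?w0// mehler_prod_ge0.
Qed.

Lemma measurable_heat_kernel2 d (X : measurableType d) (w : X -> R -> R) :
  measurable_fun setT (fun v : X * R => w v.1 v.2) ->
  measurable_fun setT (fun v : (X * T) * T => heat_kernel (w v.1.1) v.1.2 v.2).
Proof.
move=> mw.
have mx : measurable_fun setT (fun v : (X * T) * T => v.1.1).
  exact: (measurableT_comp measurable_fst measurable_fst).
have mp : measurable_fun setT (fun v : (X * T) * T => v.1.2).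
  exact: (measurableT_comp measurable_snd measurable_fst).
have mq : measurable_fun setT (fun v : (X * T) * T => v.2) by exact: measurable_snd.
have mp1 : measurable_fun setT (fun v : (X * T) * T => v.1.2.1 : R).
  exact: (measurableT_comp measurable_fst mp).
have mq1 : measurable_fun setT (fun v : (X * T) * T => v.2.1 : R).
  exact: (measurableT_comp measurable_fst mq).
have md : measurable_fun setT (fun v : (X * T) * T => (v.1.2.1 : R) - (v.2.1 : R)).
  exact: measurable_funB.
apply: measurable_funM; first exact: measurableT_comp.
apply: measurable_funM.
  by apply: (measurableT_comp mw (g := fun v : (X * T) * T => (v.1.1, (v.1.2.1 : R) - v.2.1)));
    exact: measurable_fun_pair.
apply: (measurableT_comp measurable_mehler_prod
  (g := fun v : (X * T) * T => ((v.1.2.1 : R) - v.2.1, (v.1.2.2, v.2.2)))).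
apply: measurable_fun_pair => //; apply: measurable_fun_pair.
  exact: (measurableT_comp measurable_snd mp).
exact: (measurableT_comp measurable_snd mq).
Qed.

Lemma measurable_heat_kernel w p : measurable_fun setT w ->
  measurable_fun setT (heat_kernel w p).
Proof.
move=> mw; have mw2 : measurable_fun setT (fun v : R * R => w v.2).
  exact: (measurableT_comp mw measurable_snd).
exact: (measurableT_comp (measurable_heat_kernel2 (w := fun _ : R => w) mw2) (pair1_measurable ((0 : R), p))).
Qed.

Lemma integral_heat_kernel w p : measurable_fun setT w -> (forall s, 0 < s -> 0 <= w s) ->
  (\int[mu]_q (heat_kernel w p q)%:E =
   \int[leb]_(s in D) ((w s)%:E * \int[lebesgue_tuple n]_z (mehler_prod s p.2 z)%:E))%E.
Proof.
move=> mw w0.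
have mk : measurable_fun setT (fun q : T => (heat_kernel w p q)%:E).
  by apply/measurable_EFinP; exact: measurable_heat_kernel.
rewrite fubini_tonelli1//; last by move=> q; rewrite lee_fin heat_kernel_ge0.
pose g (s : R) : \bar R := (\int[lebesgue_tuple n]_z (\1_D s * (w s * mehler_prod s p.2 z))%:E)%E.
have g0 s z : (0 <= (\1_D s * (w s * mehler_prod s p.2 z))%:E)%E.
  rewrite lee_fin indicE D0; case: ltP => h; last by rewrite mul0r.
  by rewrite mul1r mulr_ge0 ?w0// mehler_prod_ge0.
have mg : measurable_fun setT g.
  apply: (@measurable_fun_fubini_tonelli_F _ _ _ _ _ (lebesgue_tuple n)
    (fun v : R * n.-tuple R => (\1_D v.1 * (w v.1 * mehler_prod v.1 p.2 v.2))%:E)).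
    apply/measurable_EFinP; apply: measurable_funM.
      by apply: measurableT_comp => //; exact: measurable_fst.
    apply: measurable_funM; first exact: (measurableT_comp mw measurable_fst).
    apply: (measurableT_comp measurable_mehler_prod (g := fun v : R * n.-tuple R => (v.1, (p.2, v.2)))).
    apply: measurable_fun_pair; first exact: measurable_fst.
    by apply: measurable_fun_pair => //; exact: measurable_snd.
  by move=> v; exact: g0.
transitivity (\int[leb]_s g (p.1 - s)%R)%E; first by [].
rewrite ge0_integral_reflection//; last by move=> s; apply: integral_ge0 => z _; exact: g0.
rewrite [RHS]integral_mkcond; apply: eq_integral => s _.
rewrite patchE /g indicE; case: ifPn => sD; last first.
  by under eq_integral do rewrite mul0r; rewrite integral0.
under eq_integral do rewrite mul1r EFinM.
rewrite ge0_integralZl//.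
- apply/measurable_EFinP.
  exact: (measurableT_comp measurable_mehler_prod (measurableT_comp (pair1_measurable s) (pair1_measurable p.2))).
- by move=> z _; rewrite lee_fin mehler_prod_ge0.
- by rewrite lee_fin w0// -D0.
Qed.

Lemma heat_kernel_bounded w p B : (1 <= n)%N -> measurable_fun setT w ->
  (forall s, 0 < s -> 0 <= w s) ->
  (\int[leb]_(s in D) (w s * expR (- s))%:E <= B%:E)%E ->
  (\int[mu]_q (heat_kernel w p q)%:E <= (Num.sqrt 2 * B)%:E)%E.
Proof.
move=> n1 mw w0 wB; rewrite integral_heat_kernel//.
have me : measurable_fun D (fun s => (w s * expR (- s))%:E).
  apply/measurable_EFinP; apply: measurable_funTS; apply: measurable_funM => //.
  by apply: measurableT_comp.
have sw s : D s -> (0 <= (w s * expR (- s))%:E)%E.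
  by move=> Ds; rewrite lee_fin mulr_ge0 ?expR_ge0// w0// -D0 inE.
apply: (@le_trans _ _ (\int[leb]_(s in D) ((Num.sqrt 2)%:E * (w s * expR (- s))%:E))%E).
  apply: ge0_le_integral => //.
  - move=> s Ds; rewrite mule_ge0 ?lee_fin ?w0// -?D0 ?inE//.
    by apply: integral_ge0 => z _; rewrite lee_fin mehler_prod_ge0.
  - apply: emeasurable_funM; first by apply/measurable_EFinP; exact: measurable_funTS.
    apply: measurable_funTS.
    apply: (@measurable_fun_fubini_tonelli_F _ _ _ _ _ (lebesgue_tuple n)
      (fun v : R * n.-tuple R => (mehler_prod v.1 p.2 v.2)%:E)).
      apply/measurable_EFinP.
      apply: (measurableT_comp measurable_mehler_prod (g := fun v : R * n.-tuple R => (v.1, (p.2, v.2)))).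
      apply: measurable_fun_pair; first exact: measurable_fst.
      by apply: measurable_fun_pair => //; exact: measurable_snd.
    by move=> v; rewrite lee_fin mehler_prod_ge0.
  - exact: measurable_funeM.
  - move=> s Ds; have s0 : 0 < s by rewrite -D0 inE.
    have [m -> [m0 [_ m2]]] := mehler_prod_mass p.2 n1 s0.
    by rewrite -!EFinM lee_fin mulrCA ler_wpM2l// w0.
rewrite ge0_integralZl ?lee_fin ?sqrtr_ge0//.
by rewrite EFinM lee_wpmul2l// lee_fin sqrtr_ge0.
Qed.

Lemma heat_kernel_mass_le w p B : (1 <= n)%N -> measurable_fun setT w ->
  (forall s, 0 < s -> 0 <= w s) ->
  (\int[leb]_(s in D) (w s)%:E <= B%:E)%E ->
  (\int[mu]_q (heat_kernel w p q)%:E <= B%:E)%E.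
Proof.
move=> n1 mw w0 wB; rewrite integral_heat_kernel//; apply: le_trans wB.
apply: ge0_le_integral => //.
- move=> s Ds; rewrite mule_ge0 ?lee_fin ?w0// -?D0 ?inE//.
  by apply: integral_ge0 => z _; rewrite lee_fin mehler_prod_ge0.
- apply: emeasurable_funM; first by apply/measurable_EFinP; exact: measurable_funTS.
  apply: measurable_funTS.
  apply: (@measurable_fun_fubini_tonelli_F _ _ _ _ _ (lebesgue_tuple n)
    (fun v : R * n.-tuple R => (mehler_prod v.1 p.2 v.2)%:E)).
    apply/measurable_EFinP.
    apply: (measurableT_comp measurable_mehler_prod (g := fun v : R * n.-tuple R => (v.1, (p.2, v.2)))).
    apply: measurable_fun_pair; first exact: measurable_fst.
    by apply: measurable_fun_pair => //; exact: measurable_snd.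
  by move=> v; rewrite lee_fin mehler_prod_ge0.
- by apply/measurable_EFinP; exact: measurable_funTS.
- move=> s Ds; have s0 : 0 < s by rewrite -D0 inE.
  have [m -> [m0 [m1 _]]] := mehler_prod_mass p.2 n1 s0.
  by rewrite -!EFinM lee_fin ler_piMr// w0.
Qed.

(** Mehler's semigroup law makes the integral over space depend on the total elapsed
    time only; what remains is the convolution of the two weights. *)
Lemma heat_kernel_comp (v w : R -> R) p r : measurable_fun setT v -> measurable_fun setT w ->
  (forall s, 0 < s -> 0 <= v s) -> (forall s, 0 < s -> 0 <= w s) ->
  (\int[mu]_q (heat_kernel v p q * heat_kernel w q r)%:E =
   (mehler_prod (p.1 - r.1) p.2 r.2)%:E *
   \int[leb]_(s in `]0%R, (p.1 - r.1)%R[) (v s * w ((p.1 - r.1) - s)%R)%:E)%E.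
Proof.
move=> mv mw v0 w0; set L := p.1 - r.1.
have mk : measurable_fun setT (fun q : T => (heat_kernel v p q * heat_kernel w q r)%:E).
  apply/measurable_EFinP; apply: measurable_funM; first exact: measurable_heat_kernel.
  have mw2 : measurable_fun setT (fun v : R * R => w v.2).
    exact: (measurableT_comp mw measurable_snd).
  apply: (measurableT_comp (measurable_heat_kernel2 (w := fun _ : R => w) mw2)
    (g := fun q : T => (((0 : R), q), r))).
  by apply: measurable_fun_pair => //; exact: measurable_fun_pair.
rewrite fubini_tonelli1//; last first.
  by move=> q; rewrite lee_fin mulr_ge0// heat_kernel_ge0.
have vw0 s : 0 <= \1_(`]0%R, L[%classic : set R) s * (v s * w (L - s)).
  rewrite indicE; case: (boolP (s \in _)) => [|_]; last by rewrite mul0r.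
  rewrite inE/= in_itv/= => /andP[s0 sL]; rewrite mul1r mulr_ge0 ?v0 ?w0// subr_gt0//.
have mvw : measurable_fun setT (fun s => v s * w (L - s)).
  apply: measurable_funM => //; apply: (measurableT_comp mw).
  exact: measurable_funB.
pose g (s : R) : \bar R :=
  ((mehler_prod L p.2 r.2)%:E * (\1_(`]0%R, L[%classic : set R) s * (v s * w (L - s)))%:E)%E.
transitivity (\int[leb]_u g (p.1 - u)%R)%E.
  apply: eq_integral => u _; rewrite /g /fubini_F /heat_kernel/=.
  have -> : L - (p.1 - u) = u - r.1 by rewrite /L; ring.
  have -> : (\1_(`]0%R, L[%classic : set R) (p.1 - u) : R) = \1_D (p.1 - u) * \1_D (u - r.1).
    rewrite !indicE !D0 -natrM mulnb; congr (_%:R); congr nat_of_bool.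
    apply/idP/idP; rewrite inE/= in_itv/= /L => /andP[h1 h2]; apply/andP; split; lra.
  rewrite !indicE !D0.
  case: ltP => [h1|_]; last by rewrite !mul0r mule0; under eq_integral do rewrite !mul0r; rewrite integral0.
  case: ltP => [h2|_]; last by rewrite mulr0 !mul0r mule0; under eq_integral do rewrite mul0r mulr0; rewrite integral0.
  have h12 : L = (p.1 - u) + (u - r.1) by rewrite /L; ring.
  rewrite h12 -mehler_prod_semigroup// muleC mulr1 mul1r.
  rewrite -ge0_integralZl//; last 3 first.
  - apply/measurable_EFinP; apply: measurable_funM.
      exact: (measurableT_comp measurable_mehler_prod (measurableT_comp (pair1_measurable (p.1 - u)) (pair1_measurable p.2))).
    exact: (measurableT_comp measurable_mehler_prod (measurableT_comp (pair1_measurable (u - r.1)) (pair2_measurable r.2))).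
  - by move=> z _; rewrite lee_fin mulr_ge0 ?mehler_prod_ge0.
  - by rewrite lee_fin mulr_ge0 ?v0 ?w0.
  have factor (a b c e : R) : 1 * (a * c) * (1 * (b * e)) = a * b * (c * e) by ring.
  by apply: eq_integral => z _; rewrite -EFinM; congr EFin; exact: factor.
rewrite ge0_integral_reflection; last 2 first.
- apply: emeasurable_funM => //; apply/measurable_EFinP; apply: measurable_funM => //.
- by move=> s; rewrite /g mule_ge0// lee_fin ?mehler_prod_ge0.
rewrite /g ge0_integralZl//; last 3 first.
- by apply/measurable_EFinP; exact: measurable_funM.
- by move=> s _; rewrite lee_fin.
- by rewrite lee_fin mehler_prod_ge0.
congr (_ * _)%E; rewrite [RHS]integral_mkcond; apply: eq_integral => s _.
by rewrite patchE indicE; case: ifPn => _; rewrite ?mul1r ?mul0r.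
Qed.

Definition spacetime_measure : {sigma_finite_measure set T -> \bar R} :=
  product_sf_measure leb (lebesgue_tuple n).

Definition poisson_spacetime_kernel k y p q := heat_kernel (stable_density k y) p q.

Let measurable_stable k y : measurable_fun setT (stable_density k y : R -> R).
Proof. exact: (measurableT_comp (measurable_stable_density k) (pair1_measurable y)). Qed.

(** Each property reduces to one of the density of the subordinator: the space
    variable only contributes the mass of Mehler's kernel. *)
Lemma poisson_spacetime_kernel_spec : (1 <= n)%N ->
  poisson_kernel spacetime_measure poisson_spacetime_kernel.
Proof.
move=> n1; split.
- move=> k; apply: (measurable_heat_kernel2 (w := stable_density k)).
  exact: measurable_stable_density.
- move=> k y p q y0; rewrite /poisson_spacetime_kernel /heat_kernel.
  set s := p.1 - q.1.
  have := is_deriveM (is_derive_stable_density k y s)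
    (is_derive_cst (\1_D s * mehler_prod s p.2 q.2) y 1).
  rewrite scaler0 add0r (_ : _ *: _ = \1_D s * (stable_density k.+1 y s * mehler_prod s p.2 q.2)).
    rewrite (_ : _ * cst _ = fun y => \1_D s * (stable_density k y s * mehler_prod s p.2 q.2))//.
    apply/funext => z; change (stable_density k z s * (\1_D s * mehler_prod s p.2 q.2) =
      \1_D s * (stable_density k z s * mehler_prod s p.2 q.2)); ring.
  by rewrite /GRing.scale/=; ring.
- move=> k a p a0.
  have km : k%:R <= k.+1%:R :> R by rewrite ler_nat.
  have [C C0 CP] := @stable_density_le R k k.+1%:R km.
  pose w s := C * (expR s * (s + a ^+ 2) `^ (- 1 - k.+1%:R / 2)).
  have w0 s : 0 < s -> 0 <= w s by move=> s0; rewrite !mulr_ge0 ?expR_ge0 ?powR_ge0.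
  have mw : measurable_fun setT w.
    apply: measurable_funM => //; apply: measurable_funM => //.
    by apply: (measurableT_comp (measurable_powR _)); exact: measurable_funD.
  exists (heat_kernel w p).
    apply/integrableP; split; first by apply/measurable_EFinP; exact: measurable_heat_kernel.
    under eq_integral do rewrite /= ger0_norm ?heat_kernel_ge0//.
    have m0 : 0 < k.+1%:R / 2 :> R by rewrite divr_gt0.
    have a20 : 0 < a ^+ 2 by rewrite exprn_gt0.
    have h := integral_powRD_le m0 a20.
    apply: le_lt_trans (heat_kernel_bounded (B := C * ((k.+1%:R / 2)^-1 * (a ^+ 2) `^ (- (k.+1%:R / 2)))) p n1 mw w0 _) _; last by rewrite ltry.
    rewrite EFinM.
    apply: le_trans (lee_wpmul2l _ h); last by rewrite lee_fin.
    rewrite -ge0_integralZl//; last 2 first.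
    - apply/measurable_EFinP; apply: measurable_funTS.
      by apply: (measurableT_comp (measurable_powR _)); exact: measurable_funD.
    - by move=> s _; rewrite lee_fin powR_ge0.
    rewrite le_eqVlt; apply/orP; left; apply/eqP; apply: eq_integral => s _.
    by rewrite -EFinM /w -mulrA mulrAC expRxMexpNx_1 mul1r.
  move=> y q ay; rewrite /poisson_spacetime_kernel /heat_kernel.
  rewrite indicE D0; case: ltP => s0; last by rewrite !mul0r normr0.
  rewrite !mul1r normrM (ger0_norm (mehler_prod_ge0 _ _ _)) ler_wpM2r ?mehler_prod_ge0//.
  have := CP y (p.1 - q.1) s0; rewrite expRN ler_pdivrMr ?expR_gt0// => /le_trans; apply.
  rewrite /w [in leRHS](mulrC (expR _)) mulrA ler_wpM2r ?expR_ge0// ler_wpM2l//.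
  rewrite -opprD ler_powRN ?addr_ge0 ?divr_ge0//; first by rewrite ltr_pwDl ?sqr_ge0.
  by rewrite lerD2l lerXn2r ?nnegrE// ?ltW// (lt_le_trans a0).
- move=> k m km; have m0 : 0 <= m by exact: le_trans km.
  have [m_gt0|m_le0] := ltP 0 m.
    have [C C0 CP] := @stable_density_le R k m km.
    have mh : 0 < m / 2 by rewrite divr_gt0.
    exists (Num.sqrt 2 * (C * (m / 2)^-1)).
      by rewrite mulr_ge0 ?sqrtr_ge0// mulr_ge0 ?invr_ge0 ?(ltW mh).
    move=> y p y0; pose w s := `|stable_density k y s|.
    have mw : measurable_fun setT w by apply: measurableT_comp.
    rewrite (_ : (fun q => _) = fun q => (heat_kernel w p q)%:E); last first.
      apply/funext => q; rewrite /poisson_spacetime_kernel /heat_kernel /w.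
      by rewrite normrM (normrM (stable_density _ _ _)) (ger0_norm (mehler_prod_ge0 _ _ _))
        indicE (ger0_norm (ler0n _ _)).
    have -> : Num.sqrt 2 * (C * (m / 2)^-1) * y `^ (- m) =
        Num.sqrt 2 * (C * ((m / 2)^-1 * (y ^+ 2) `^ (- (m / 2)))).
      rewrite -powR_mulrn ?(ltW y0)// -powRrM -!mulrA; congr (_ * (_ * (_ * _ `^ _))).
      by field.
    apply: heat_kernel_bounded => //; first by move=> s _; exact: normr_ge0.
    have y20 : 0 < y ^+ 2 by rewrite exprn_gt0.
    have h := integral_powRD_le mh y20.
    rewrite EFinM; apply: le_trans (lee_wpmul2l _ h); last by rewrite lee_fin.
    rewrite -ge0_integralZl//; last 2 first.
    - apply/measurable_EFinP; apply: measurable_funTS.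
      by apply: (measurableT_comp (measurable_powR _)); exact: measurable_funD.
    - by move=> s _; rewrite lee_fin powR_ge0.
    apply: ge0_le_integral => //.
    - by move=> s _; rewrite lee_fin mulr_ge0 ?expR_ge0 ?normr_ge0.
    - apply/measurable_EFinP; apply: measurable_funTS; apply: measurable_funM => //.
      by apply: measurableT_comp.
    - apply/measurable_EFinP; apply: measurable_funTS; apply: measurable_funM => //.
      by apply: (measurableT_comp (measurable_powR _)); exact: measurable_funD.
    - by move=> s Ds; rewrite -EFinM lee_fin; apply: CP; rewrite -D0 inE.
  have mE : m = 0 by apply/eqP; rewrite eq_le m_le0.
  have -> : k = 0%N.
    by move: km; rewrite mE lern0 => /eqP.
  have [C C0 CP] := @stable_density0_le R.
  exists (C * 2) => [|y p y0]; first exact: mulr_ge0.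
  rewrite mE oppr0 powRr0 mulr1.
  under eq_integral => q _.
    rewrite ger0_norm; last by apply: heat_kernel_ge0 => s _; rewrite stable_density0_ge0// ltW.
    over.
  apply: heat_kernel_mass_le => //; first by move=> s _; rewrite stable_density0_ge0// ltW.
  have y20 : 0 < y ^+ 2 by rewrite exprn_gt0.
  have h20 : 0 < 2^-1 :> R by rewrite invr_gt0.
  have h := integral_powRD_le h20 y20.
  have -> : C * 2 = C * y * (2^-1^-1 * (y ^+ 2) `^ (- 2^-1)).
    rewrite -powR_mulrn ?(ltW y0)// -powRrM (_ : 2%:R * - 2^-1 = - 1); last by field.
    by rewrite powR_inv1 ?(ltW y0)// invrK; field; rewrite gt_eqF.
  rewrite EFinM; apply: le_trans (lee_wpmul2l _ h); last by rewrite lee_fin mulr_ge0 ?(ltW y0).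
  rewrite -ge0_integralZl//; last 3 first.
  - apply/measurable_EFinP; apply: measurable_funTS.
    by apply: (measurableT_comp (measurable_powR _)); exact: measurable_funD.
  - by move=> s _; rewrite lee_fin powR_ge0.
  - by rewrite lee_fin mulr_ge0 ?(ltW y0).
  apply: ge0_le_integral => //.
  - by move=> s _; rewrite lee_fin stable_density0_ge0 ?ltW.
  - by apply/measurable_EFinP; apply: measurable_funTS; exact: measurable_stable.
  - apply/measurable_EFinP; apply: measurable_funTS; apply: measurable_funM => //.
    by apply: (measurableT_comp (measurable_powR _)); exact: measurable_funD.
  - by move=> s Ds; rewrite -EFinM lee_fin -mulrA; apply: CP => //; rewrite -D0 inE.
- by move=> y p q y0; apply: heat_kernel_ge0 => s _; rewrite stable_density0_ge0// ltW.
- move=> a b p r a0 b0.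
  rewrite heat_kernel_comp//; [|by move=> s _; rewrite stable_density0_ge0// ltW..].
  rewrite /poisson_spacetime_kernel /heat_kernel indicE D0; case: ltP => s0.
    by rewrite stable_convolution// -EFinM mul1r mulrC.
  by rewrite mul0r set_itv_ge ?integral_set0 ?mule0// bnd_simp -leNgt.
Qed.

End spacetime_kernel.

(** * The integral formula for the space-time semigroup *)

Section scaling.
Context {R : realType} d {T : measurableType d} (mu : {measure set T -> \bar R}).

(** Positive factors preserve the infinite values of the integrals of the positive
    and negative parts, hence the finite part of their difference. *)
Lemma Rintegral_pZl (D : set T) (k : R) (f : T -> R) : 0 < k ->
  measurable D -> measurable_fun D f ->
  \int[mu]_(x in D) (k * f x) = k * \int[mu]_(x in D) f x.
Proof.
move=> k0 mD mf; have mE : measurable_fun D (EFin \o f) by exact/measurable_EFinP.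
rewrite /Rintegral [in LHS]integralE [in RHS]integralE.
have -> : (fun x => (k * f x)%:E) = (fun x => (k%:E * (EFin \o f) x)%E) by [].
rewrite ge0_funeposM ?(ltW k0)// ge0_funenegM ?(ltW k0)//.
rewrite !ge0_integralZl ?lee_fin ?(ltW k0)//;
  [|exact: measurable_funeneg|exact: measurable_funepos].
have : (0 <= \int[mu]_(x in D) (EFin \o f)^\+ x)%E by exact: integral_ge0.
have : (0 <= \int[mu]_(x in D) (EFin \o f)^\- x)%E by exact: integral_ge0.
move: (\int[mu]_(x in D) _)%E (\int[mu]_(x in D) _)%E => [a| |] [b| |] //= _ _;
  rewrite ?gt0_muley ?lte_fin//= ?mulr0//.
by rewrite mulrBr.
Qed.

End scaling.

Section poisson_formula.
Context {R : realType} {n : nat}.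
Notation leb := (@lebesgue_measure R).
Notation T := (spacetime R n).
Notation D := (`]0%R, +oo[%classic : set R).
Hypothesis n_ge1 : (1 <= n)%N.

Let D0 s : (s \in D) = (0 < s).
Proof. by apply/idP/idP; rewrite inE/= in_itv/= andbT. Qed.

Let pk := @poisson_spacetime_kernel_spec R n n_ge1.
Let mu := @spacetime_measure R n.
Let K := @poisson_spacetime_kernel R n.

(** The product agrees almost everywhere with the one for the truncation of f. *)
Lemma poisson_kernel_Linfty_integrable y f (p : T) : 0 < y -> Linfty mu f ->
  mu.-integrable setT (fun q => (K 0 y p q * f q)%:E).
Proof.
move=> y0 /LinftyP[mf nf].
have Mf : Linfty_norm mu f = (fine (Linfty_norm mu f))%:E.
  by rewrite fineK// ge0_fin_numE// Linfty_norm_ge0.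
pose M := fine (Linfty_norm mu f).
have M0 : 0 <= M by rewrite fine_ge0// Linfty_norm_ge0.
have bM := bounded_clip M0 mf.
have /integrableP[mg gi] := kernel_op_integrable pk bM 0 p y0.
have mk : measurable_fun setT (K 0 y p).
  by have /integrableP[/measurable_EFinP] := kernel_integrable pk 0 p y0.
have mh : measurable_fun setT (fun q => (K 0 y p q * f q)%:E).
  by apply/measurable_EFinP; exact: measurable_funM.
apply/integrableP; split => //.
apply: le_lt_trans gi; rewrite le_eqVlt; apply/orP; left; apply/eqP.
apply: ae_eq_integral => //.
- exact: measurableT_comp.
- exact: measurableT_comp.
have := Linfty_norm_ae mu f; apply: filterS => q; rewrite Mf lee_fin => h _ /=.
by rewrite clip_id.
Qed.

(** The integrand at elapsed time s and space point z. *)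
Let slice y (f : T -> R) (p : T) (s : R) (z : n.-tuple R) : R :=
  K 0 y p ((p.1 : R) - s, z) * f ((p.1 : R) - s, z).

Let sliceE y f p s z : slice y f p s z =
  \1_D s * (stable_density 0 y s * mehler_prod s p.2 z) * f ((p.1 : R) - s, z).
Proof. by rewrite /slice /K /poisson_spacetime_kernel /heat_kernel/= subKr. Qed.

Let measurable_slice y f p : measurable_fun setT f -> 0 < y ->
  measurable_fun setT (fun v : R * n.-tuple R => slice y f p v.1 v.2).
Proof.
move=> mf y0; have mk : measurable_fun setT (K 0 y p).
  by have /integrableP[/measurable_EFinP] := kernel_integrable pk 0 p y0.
apply: (measurableT_comp (measurable_funM mk mf)
  (g := fun v : R * n.-tuple R => ((p.1 : R) - v.1, v.2))).
by apply: measurable_fun_pair => //; exact: measurable_funB.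
Qed.

(** Fubini, followed by the reflection exchanging the time of q and the elapsed
    time.  For almost every s the section is integrable, and there the inner
    integral may be taken real-valued. *)
Lemma poisson_kernel_op_slice y f (p : T) : 0 < y -> Linfty mu f ->
  kernel_op mu K 0 y f p =
  \int[leb]_s \int[lebesgue_tuple n]_z slice y f p s z.
Proof.
move=> y0 fL; have iF := poisson_kernel_Linfty_integrable p y0 fL.
pose G (s : R) := (\int[lebesgue_tuple n]_z (slice y f p s z)%:E)%E.
have FE : fubini_F (lebesgue_tuple n) (fun q : T => (K 0 y p q * f q)%:E) = (fun u => G (p.1 - u)%R).
  by apply/funext => u; rewrite /G /slice/= /fubini_F/= subKr.
have iG : leb.-integrable setT (fun u => G (p.1 - u)%R).
  by rewrite -FE; exact: (integrable_fubini_F iF).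
have mf : measurable_fun setT f by have [] := (LinftyP mu f).1 fL.
have mG : measurable_fun setT G.
  rewrite (_ : G = (fun u => G (p.1 - u)%R) \o (fun u : R => p.1 - u)).
    by apply: measurableT_comp; [have /integrableP[] := iG|exact: measurable_funB].
  by apply/funext => u /=; rewrite subKr.
have iG' : leb.-integrable setT G.
  apply/integrableP; split => //.
  rewrite -(ge0_integral_reflection (p.1 : R)) => [|//|s]; last exact: abse_ge0.
    by have /integrableP[] := iG.
  exact: measurableT_comp.
have -> : kernel_op mu K 0 y f p = fine (\int[leb]_s G s)%E.
  congr fine; rewrite -(integral_reflection (p.1 : R) iG') -FE; apply/esym.
  exact: (integral12_prod_meas1 iF).
congr fine; apply: ae_eq_integral => //.
  by apply/measurable_EFinP; exact: (measurable_Rintegral (F := slice y f p) (lebesgue_tuple n) (measurable_slice p mf y0)).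
have := integrable_ae measurableT iG'; apply: filterS => s /(_ I) h _ /=.
by rewrite fineK.
Qed.

Lemma poissonLE y f (p : T) : 0 < y -> Linfty mu f -> poissonL y f p = kernel_op mu K 0 y f p.
Proof.
move=> y0 fL; rewrite poisson_kernel_op_slice//.
have mf : measurable_fun setT f by have [] := (LinftyP mu f).1 fL.
have c0 : 0 < y / (2 * Num.sqrt pi).
  by rewrite divr_gt0// mulr_gt0// sqrtr_gt0 pi_gt0.
pose S s := \int[lebesgue_tuple n]_z slice y f p s z.
have mS : measurable_fun setT S.
  exact: (measurable_Rintegral (F := slice y f p) (lebesgue_tuple n) (measurable_slice p mf y0)).
rewrite /poissonL /subordination.
transitivity (y / (2 * Num.sqrt pi) * \int[leb]_(s in D) ((y / (2 * Num.sqrt pi))^-1 * S s)).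
  congr (_ * _); apply: eq_Rintegral => s sD.
  have s0 : 0 < s by rewrite -D0.
  have r0 : 0 < (y / (2 * Num.sqrt pi)) / s `^ (3 / 2).
    by rewrite divr_gt0// powR_gt0.
  have -> : S s = \int[lebesgue_tuple n]_z ((y / (2 * Num.sqrt pi)) / s `^ (3 / 2) *
     (expR (- (y ^+ 2 / (4 * s))) * mehler s p.2 z * f (p.1 - s, z))).
    apply: eq_Rintegral => z _; rewrite sliceE indicE sD mul1r stable_density0E// mehlerE//.
    rewrite (_ : s `^ (3 / 2) = Num.sqrt s ^+ 3); last first.
      by rewrite (mulrC 3) powRrM powR12_sqrt ?(ltW s0)// powR_mulrn ?sqrtr_ge0.
    rewrite -exprVn; move: (expR _) (mehler_prod _ _ _) (f _) => e m g; rewrite invfM; ring.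
  rewrite Rintegral_pZl//; last first.
    under eq_fun do rewrite mehlerE//.
    apply: measurable_funM; last exact: (measurableT_comp mf (pair1_measurable ((p.1 : R) - s))).
    apply: measurable_funM => //.
    exact: (measurableT_comp measurable_mehler_prod (measurableT_comp (pair1_measurable s) (pair1_measurable p.2))).
  by rewrite mulrA mulrA mulVf ?gt_eqF// mul1r mulrC.
rewrite Rintegral_pZl ?invr_gt0//; last exact: measurable_funTS.
rewrite mulVKf ?gt_eqF//; congr fine; rewrite integral_mkcond; apply: eq_integral => s _.
rewrite patchE; case: ifPn => // /negbTE sD.
rewrite /Rintegral; under eq_integral do rewrite sliceE indicE sD !mul0r.
by rewrite integral0.
Qed.

End poisson_formula.

(** * Functions of the second variable *)

Section cylindrical_functions.
Context {R : realType} d1 d2 {X : measurableType d1} {Y : measurableType d2}.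
Variables (m1 : {sigma_finite_measure set X -> \bar R}) (m2 : {sigma_finite_measure set Y -> \bar R}).
Hypothesis m1_gt0 : (0 < m1 setT)%E.
Variable x0 : X.

(** Almost every section of a null set is null, and since m1 is not zero there is
    at least one such section. *)
Lemma ae_prod_snd (P : Y -> Prop) :
  {ae product_sf_measure m1 m2, forall q, P q.2} <-> {ae m2, forall y, P y}.
Proof.
split=> -[A [mA A0 PA]]; last first.
  exists (setT `*` A); split.
  - exact: measurableX.
  - by rewrite [LHS]product_measure1E//; rewrite [m2 A]A0 mule0.
  - by move=> [x y] /= /PA.
have : ae_eq m1 setT (fun x => m2 (xsection A x)) (cst 0%E).
  apply/ae_eq_integral_abs => //; first exact: measurable_fun_xsection.
  by rewrite -[RHS]A0; apply: eq_integral => x _; rewrite gee0_abs.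
move=> [B [mB B0 PB]].
have [x Bx] : exists x, ~ B x.
  apply/existsNP => BT; move: m1_gt0; rewrite (_ : setT = B) ?[m1 B]B0 ?ltxx//.
  by apply/seteqP; split.
exists (xsection A x); split.
- exact: measurable_xsection.
- by apply: contrapT => h; apply: Bx; apply: PB => /(_ I).
- by move=> y Py; rewrite /xsection/= inE; exact: PA.
Qed.

Lemma Linfty_norm_snd (h : Y -> R) :
  Linfty_norm (product_sf_measure m1 m2) (h \o snd) = Linfty_norm m2 h.
Proof.
rewrite /Linfty_norm unlock.
have -> : (0 < product_sf_measure m1 m2 setT)%E = (0 < m2 setT)%E.
  have -> : product_sf_measure m1 m2 setT = (m1 setT * m2 setT)%E.
    by rewrite -setXTT; exact: product_measure1E.
  have [h0|] := ltP 0%E (m2 setT); first by rewrite mule_gt0.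
  by rewrite measure_le0 => /eqP ->; rewrite mule0 ltxx.
case: ifPn => // _; apply/eqP; rewrite eq_le; apply/andP; split; apply/ess_supP.
  by apply/(ae_prod_snd (fun y => (`|(h y)%:E| <= _)%E)); exact: ess_sup_ge.
apply/(ae_prod_snd (fun y => (`|(h y)%:E| <= _)%E)).
exact: (ess_sup_ge (product_sf_measure m1 m2) (abse \o (EFin \o (h \o snd)))).
Qed.

Lemma Linfty_snd (h : Y -> R) : Linfty (product_sf_measure m1 m2) (h \o snd) <-> Linfty m2 h.
Proof.
split => /LinftyP[mh nh]; apply/LinftyP; split.
- exact: (measurableT_comp mh (pair1_measurable x0)).
- by rewrite -Linfty_norm_snd.
- exact: (measurableT_comp mh measurable_snd).
- by rewrite Linfty_norm_snd.
Qed.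

Variables (P : R -> (X * Y -> R) -> X * Y -> R) (Q : R -> (Y -> R) -> Y -> R).
Hypothesis PQ : forall y (g : Y -> R), P y (g \o snd) = Q y g \o snd.

Lemma zygmund_bounds_snd alpha (g : Y -> R) :
  zygmund_bounds (product_sf_measure m1 m2) P alpha (g \o snd) = zygmund_bounds m2 Q alpha g.
Proof.
have normE k y : Linfty_norm (product_sf_measure m1 m2)
      (fun p => derive1n k (fun s => P s (g \o snd) p) y) =
    Linfty_norm m2 (fun x => derive1n k (fun s => Q s g x) y).
  rewrite -Linfty_norm_snd; congr Linfty_norm; apply/funext => p.
  by apply: (congr1 (fun u => derive1n k u y)); apply/funext => s; rewrite PQ.
apply/seteqP; split => C hC y y0; apply: le_trans (hC y y0); rewrite le_eqVlt.
  by apply/orP; left; apply/eqP; exact/esym/normE.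
by apply/orP; left; apply/eqP; exact: normE.
Qed.

Lemma Lambda_snd alpha (g : Y -> R) :
  Lambda (product_sf_measure m1 m2) P alpha (g \o snd) <-> Lambda m2 Q alpha g.
Proof.
by split=> -[h1 h2]; split; [exact/Linfty_snd|rewrite -zygmund_bounds_snd|exact/Linfty_snd|rewrite zygmund_bounds_snd].
Qed.

Lemma Lambda_norm_snd alpha (g : Y -> R) :
  Lambda_norm (product_sf_measure m1 m2) P alpha (g \o snd) = Lambda_norm m2 Q alpha g.
Proof. by rewrite /Lambda_norm zygmund_bounds_snd Linfty_norm_snd. Qed.

End cylindrical_functions.

Theorem theorem6 (R : realType) (n : nat) (n_ge1 : (1 <= n)%N)
    (alpha beta : R) (alpha_gt0 : 0 < alpha) (beta_gt0 : 0 < beta) :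
  exists C : R,
    ((forall f : spacetime R n -> R, LambdaL alpha f ->
        LambdaL (alpha + 2 * beta) (powerL beta f) /\
        (LambdaL_norm (alpha + 2 * beta) (powerL beta f)
           <= C%:E * LambdaL_norm alpha f)%E) /\
     (forall g : n.-tuple R -> R, LambdaH alpha g ->
        LambdaH (alpha + 2 * beta) (powerH beta g) /\
        (LambdaH_norm (alpha + 2 * beta) (powerH beta g)
           <= C%:E * LambdaH_norm alpha g)%E)) /\
    ((forall f : spacetime R n -> R, LinftyL f ->
        LambdaL beta (powerL beta f) /\
        (LambdaL_norm beta (powerL beta f) <= C%:E * LinftyL_norm f)%E) /\
     (forall g : n.-tuple R -> R, LinftyH g ->
        LambdaH beta (powerH beta g) /\
        (LambdaH_norm beta (powerH beta g) <= C%:E * LinftyH_norm g)%E)).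
Proof.
have pk := @poisson_spacetime_kernel_spec R n n_ge1.
have [C1 C10 H1] := regularity_of_negative_power pk (@poissonLE R n n_ge1) beta_gt0 alpha_gt0.
have [C2 C20 H2] := negative_power_Linfty pk (@poissonLE R n n_ge1) beta_gt0.
have leb_gt0 : (0 < (@lebesgue_measure R) setT)%E.
  by rewrite -set_itvNyy lebesgue_measure_itv/= ltry.
(* On functions of the space variable the two formulas coincide literally. *)
have PQ y (g : n.-tuple R -> R) : @poissonL R n y (g \o snd) = poissonH y g \o snd by [].
have S1 := Lambda_snd (lebesgue_tuple n) leb_gt0 0 PQ.
have S2 := Lambda_norm_snd (lebesgue_tuple n) leb_gt0 PQ.
have S3 := Linfty_snd (lebesgue_tuple n) leb_gt0 0.
have S4 := Linfty_norm_snd (lebesgue_tuple n) leb_gt0.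
have {}H1 (f : spacetime R n -> R) : LambdaL alpha f ->
    LambdaL (alpha + 2 * beta) (powerL beta f) /\
    (LambdaL_norm (alpha + 2 * beta) (powerL beta f) <= (C1 + C2)%:E * LambdaL_norm alpha f)%E.
  move=> fL; have [h1 h2] := H1 f fL; split => //; apply: (le_trans h2).
  by rewrite lee_wpmul2r// ?lee_fin ?lerDl//; exact: Lambda_norm_ge0.
have {}H2 (f : spacetime R n -> R) : LinftyL f -> LambdaL beta (powerL beta f) /\
    (LambdaL_norm beta (powerL beta f) <= (C1 + C2)%:E * LinftyL_norm f)%E.
  move=> fL; have [h1 h2] := H2 f fL; split => //; apply: (le_trans h2).
  by rewrite lee_wpmul2r// ?lee_fin ?lerDr//; exact: Linfty_norm_ge0.
exists (C1 + C2); split; split => //.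
  move=> g /S1 gL; have [h1 h2] := H1 _ gL; split; first exact/S1.
  by move: h2; rewrite /LambdaH_norm -!S2.
move=> g /S3 gL; have [h1 h2] := H2 _ gL; split; first exact/S1.
by move: h2; rewrite /LambdaH_norm /LinftyH_norm -S2 -S4.
Qed.
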